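(* Consider the generalized Pólya urn with $A\ge2$ agents constructed via the exponential embedding. Let $a\in[A-1]$, assume that at least $a+1$ of the feedback functions satisfy $\sum_{k}1/F_j(k)<\infty$, and that agents $1,\dots,a$ are among them. Set $S=\min\{T_i: i=a+1,\dots,A\}$ and $S_i=\min\{T_j:j\in[A]\setminus\{i\}\}$. Then $$\mathbb{P}\big(X_1(\infty)=x_1,\dots,X_a(\infty)=x_a\big)\sim\frac{\mathbb{E}\big[\prod_{i=1}^ag_i(S)\big]}{\prod_{i=1}^a\mathbb{E}\, g_i(S_i)}\cdot\prod_{i=1}^a\mathbb{P}(X_i(\infty)=x_i)\quad\text{as }x_1,\dots,x_a\to\infty$$ (i.e. the ratio of the two sides tends to $1$ as $\min_i x_i\to\infty$).
   Context: $\mathbb{N}=\{1,2,\dots\}$, $[A]=\{1,\dots,A\}$, $e^{(i)}$ the $i$-th unit vector. For each $i\in[A]$ let $F_i\colon\mathbb{N}\to(0,\infty)$ and $X_i(0)\in\mathbb{N}$. Let $\Xi_1,\dots,\Xi_A$ be independent pure birth processes: $\Xi_i$ has independent sojourn times $\tau_i(k)$, $k\ge X_i(0)$, exponential with rate $F_i(k)$, and $\Xi_i(t)=\min\{k:\sum_{l=X_i(0)}^k\tau_i(l)>t\}$ (min of empty set $=\infty$). $T_i=\sum_{k\ge X_i(0)}\tau_i(k)\in(0,\infty]$ is its explosion time, with density $g_i$ when $\sum_k 1/F_i(k)<\infty$. With $\Xi=(\Xi_1,\dots,\Xi_A)$, $t_0=0$, $t_{n+1}=\inf\{t>t_n:\Xi(t)\ne\Xi(t_n)\}$,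 the urn is $X(n)=\Xi(t_n)$, a Markov chain with $\mathbb{P}(X(n+1)-X(n)=e^{(i)}\mid X(n))=F_i(X_i(n))/\sum_jF_j(X_j(n))$. $\mathbb{P}$ is the law of the birth processes; $X_i(\infty)=\lim_n X_i(n)$. *)

(* Defs.v *)
From HB Require Import structures.
From mathcomp Require Import all_boot all_order all_algebra.
From mathcomp Require Import all_classical all_reals all_analysis.
From mathcomp Require Import exponential_distribution.
Set Implicit Arguments. Unset Strict Implicit. Unset Printing Implicit Defensive.
Import Order.TTheory GRing.Theory Num.Theory.
Import numFieldNormedType.Exports.
Local Open Scope classical_set_scope.
Local Open Scope ring_scope.

Section Urn.
Context {R : realType} {d : measure_display} {Omega : measurableType d}.
Variables (A : nat) (X0 : 'I_A -> nat) (tau : 'I_A -> nat -> Omega -> R).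

(* Xi_i(t) = min{k : sum_{l = X_i(0)}^k tau_i(l) > t}; None encodes +infinity
   (min of the empty set). *)
Definition birth_pred (i : 'I_A) (t : \bar R) (w : Omega) (k : nat) : bool :=
  (t < (\sum_(X0 i <= l < k.+1) tau i l w)%:E)%E.

Definition Xi (i : 'I_A) (t : \bar R) (w : Omega) : option nat :=
  match pselect (exists k, birth_pred i t w k) with
  | left H => Some (ex_minn H)
  | right _ => None
  end.

Fixpoint jump_time (n : nat) (w : Omega) : \bar R :=
  match n with
  | 0 => 0%E
  | n'.+1 => ereal_inf [set x : \bar R | exists t : R, x = t%:E /\
               (jump_time n' w < x)%E /\
               exists j : 'I_A, Xi j x w <> Xi j (jump_time n' w) w]
  end.

Definition urn (i : 'I_A) (n : nat) (w : Omega) : option nat :=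
  Xi i (jump_time n w) w.

Definition urn_limit_is (i : 'I_A) (x : nat) : set Omega :=
  [set w | exists N : nat, forall n : nat, (N <= n)%N -> urn i n w = Some x].

Definition explosion_time (i : 'I_A) (w : Omega) : \bar R :=
  (\sum_(X0 i <= k <oo) (tau i k w)%:E)%E.

End Urn.

Definition summable_feedback {R : realType} (f : nat -> R) : Prop :=
  (\sum_(1 <= k <oo) ((f k)^-1)%:E < +oo)%E.

Definition is_density {R : realType} {d : measure_display}
  {Omega : measurableType d} (P : probability Omega R)
  (X : Omega -> \bar R) (g : R -> R) : Prop :=
  measurable_fun [set: R] g /\ (forall x, 0 <= g x) /\
  forall B : set R, measurable B ->
    P (X @^-1` [set y%:E | y in B]) =
      (\int[lebesgue_measure]_(x in B) (g x)%:E)%E.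

Definition sojourn_independent {R : realType} {d : measure_display}
  {Omega : measurableType d} (P : probability Omega R) (A : nat)
  (X0 : 'I_A -> nat) (tau : 'I_A -> nat -> Omega -> R) : Prop :=
  forall (J : seq ('I_A * nat)) (B : 'I_A * nat -> set R),
    uniq J -> (forall j, j \in J -> (X0 j.1 <= j.2)%N) ->
    (forall j, measurable (B j)) ->
    P [set w | forall j, j \in J -> B j (tau j.1 j.2 w)] =
      (\prod_(j <- J) fine (P (tau j.1 j.2 @^-1` B j)))%:E.

(* Main.v *)
(** Let [T* = min_i T_i].  Almost surely the jump times of the urn increase to [T*], so
[X_i(oo) = x] means that the birth process [i] sits in [x] just before [T*], and the event
of the theorem is [{sigma_i(x_i) < S <= sigma_i(x_i + 1), i <= a}] with
[sigma_i(x) = sum_(X_i(0) <= l < x) tau_i(l)].  Integrating out [tau_i(x_i)], and then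
exchanging the roles of [tau_i(x_i)] and [tau_i(X_i(0))] in the convolution of their two
exponential laws, gives the exact identity
  [prod_i F_i(x_i) * P(event) = E prod_i e_i (S - sum_(X_i(0) < l <= x_i) tau_i(l))],
where [e_i] is the exponential density of rate [F_i(X_i(0))].  Since [e_i] is bounded and
right-continuous, dominated convergence sends the right-hand side to
[E prod_i e_i (S - rho_i)] with [rho_i = sum_(l > X_i(0)) tau_i(l)]; as [rho_i] is
independent of the rest and [v |-> E e_i (v - rho_i)] is a version of [g_i], this limit is
[E prod_i g_i (S)].  The case of a single agent gives
[F_i(x) * P(X_i(oo) = x) --> E g_i (S_i)], and the factors [F_i(x_i)] cancel. *)
Require Import Defs.
From HB Require Import structures.
From mathcomp Require Import all_boot all_order all_algebra.
From mathcomp Require Import all_classical all_reals all_analysis.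
From mathcomp Require Import measurable_realfun measurable_fun_approximation exponential_distribution.
From mathcomp Require Import ring lra zify.
Import Order.TTheory GRing.Theory Num.Theory.
Import numFieldNormedType.Exports.
Local Open Scope classical_set_scope.
Local Open Scope ring_scope.
Set Implicit Arguments.
Unset Strict Implicit.
Unset Printing Implicit Defensive.

(** * Independence *)

(** The exchange of clocks is what makes a passage to the limit possible. Summability of [1 / F_i]
    forces [F_i] to infinity, so the density of the clock [x_i] has no bound uniform in [x_i]; once
    the clock [X_i(0)] has taken over its role, the rates are fixed and their product dominates.

    All agents of the event share the same time [S], but [S] depends only on the clocks of the
    agents outside the event. Each exchange can therefore be done with everything belonging to the
    other agents held as a parameter, and no joint computation is needed.

    A density [g_i] is given only up to null sets, while the statement evaluates it at a random
    time. This is harmless because [S] is almost surely finite, thanks to a summable agent outside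
    the event, and has an absolutely continuous law.

    Dividing two limits requires positive limits. Positivity is read off the exponential form: for a
    suitable [e > 0] the event [S >= e], all [rho_i <= e], has positive probability, and on it the
    limiting integrand is positive. *)

Section Independence.
Context {R : realType} {d : measure_display} {Omega : measurableType d}.
Variable P : probability Omega R.

(** Both sides are finite measures in [A], the right one being [P] scaled by [P C]; agreeing on a
    pi-system that contains [setT], they agree on the sigma-algebra it generates. *)
Lemma indep_sigma_algebra (G : set (set Omega)) (C : set Omega) :
  measurable C -> G `<=` measurable -> setI_closed G -> G setT ->
  (forall A, G A -> P (A `&` C) = (P A * P C)%E) ->
  forall A, <<s G >> A -> P (A `&` C) = (P A * P C)%E.
Proof.
move=> mC mG IG GT GC A sA.
have k0 : 0 <= fine (P C) by rewrite fine_ge0.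
pose m2 := [the measure _ _ of mscale (NngNum k0) P].
have m2E B : m2 B = (P B * P C)%E.
  by rewrite /m2 /= /mscale /= fineK ?fin_num_measure// muleC.
rewrite -m2E -[LHS]/(mrestr P mC A).
apply: (@g_sigma_algebra_measure_unique _ _ _ G mG (fun=> setT)) => //.
- by rewrite bigcup_const//; exists 0%N.
- by move=> B GB; rewrite m2E /= /mrestr GC.
- by move=> _; rewrite /= /mrestr setTI -ge0_fin_numE// fin_num_measure.
Qed.

(** Independence makes the joint law of [U] and [W] the product of their laws, so this is Tonelli
    between changes of variables. *)
Lemma indep_fubini d1 d2 (T1 : measurableType d1) (T2 : measurableType d2)
    (U : Omega -> T1) (W : Omega -> T2) (f : T1 * T2 -> \bar R) :
  measurable_fun setT U -> measurable_fun setT W ->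
  (forall B C, measurable B -> measurable C ->
     P (U @^-1` B `&` W @^-1` C) = (P (U @^-1` B) * P (W @^-1` C))%E) ->
  measurable_fun setT f -> (forall z, 0 <= f z)%E ->
  (\int[P]_w f (U w, W w) = \int[P]_w \int[P]_v f (U v, W w))%E.
Proof.
move=> mU mW UW mf f0.
pose U' : {mfun Omega >-> T1} := HB.pack U (isMeasurableFun.Build _ _ _ _ _ mU).
pose W' : {mfun Omega >-> T2} := HB.pack W (isMeasurableFun.Build _ _ _ _ _ mW).
have mUW : measurable_fun setT (fun w => (U w, W w)) by apply: measurable_fun_pair.
pose V' : {mfun Omega >-> (T1 * T2)%type} :=
  HB.pack (fun w => (U w, W w)) (isMeasurableFun.Build _ _ _ _ _ mUW).
rewrite -[LHS](@ge0_integral_distribution _ _ _ _ _ P V' f)//.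
rewrite (@eq_measure_integral _ _ _ setT (distribution P U' \x distribution P W')%E);
  last first.
  move=> A mA _; apply/esym; apply: product_measure_unique => //.
rewrite fubini_tonelli2//.
rewrite (@ge0_integral_distribution _ _ _ _ _ P W'); last 2 first.
- exact: measurable_fun_fubini_tonelli_G.
- by move=> y; apply: integral_ge0.
apply: eq_integral => w _; rewrite /= /fubini_G.
rewrite (@ge0_integral_distribution _ _ _ _ _ P U' (fun x => f (x, W w)))//.
exact: measurable_fun_pair1.
Qed.

End Independence.

(** * Independence of disjoint blocks of variables *)

Section Cylinders.
Context {R : realType} {d : measure_display} {Omega : measurableType d}.
Variables (I : eqType) (X : I -> Omega -> R).

(** These are the events in the hypothesis [sojourn_independent], which therefore applies to them
    verbatim. *)
Definition cylinders (K : set I) : set (set Omega) :=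
  [set E | exists (J : seq I) (B : I -> set R),
    [/\ uniq J, (forall j, j \in J -> K j), (forall j, measurable (B j)) &
        E = [set w | forall j, j \in J -> B j (X j w)]]].

Lemma cylindersT K : cylinders K setT.
Proof.
by exists [::], (fun=> setT); split => //; apply/seteqP; split.
Qed.

Lemma cylindersI K : setI_closed (cylinders K).
Proof.
move=> _ _ [J1 [B1 [u1 K1 m1 ->]]] [J2 [B2 [u2 K2 m2 ->]]].
(* A common index gets the intersection of its two sets, an index of only one list is padded with
   [setT], and [undup] restores uniqueness. *)
exists (undup (J1 ++ J2)), (fun j => (if j \in J1 then B1 j else setT) `&`
  (if j \in J2 then B2 j else setT)); split.
- exact: undup_uniq.
- by move=> j; rewrite mem_undup mem_cat => /orP[/K1|/K2].
- by move=> j; apply: measurableI; case: ifP.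
- apply/seteqP; split => w /=.
    by move=> [h1 h2] j _; split; case: ifP => // jJ; [exact: h1|exact: h2].
  move=> h; split => j jJ; have [] := h j _; rewrite ?mem_undup ?mem_cat ?jJ ?orbT//.
Qed.

Lemma cylinders_preimage (K : set I) j B : K j -> measurable B ->
  cylinders K (X j @^-1` B).
Proof.
move=> Kj mB; exists [:: j], (fun=> B); split => //.
- by move=> i; rewrite inE => /eqP ->.
- apply/seteqP; split => w /=; first by move=> h i; rewrite inE => /eqP ->.
  by apply; rewrite inE.
Qed.

Lemma cylinders_measurable K : (forall j, K j -> measurable_fun setT (X j)) ->
  cylinders K `<=` measurable.
Proof.
move=> mX _ [J [B [uJ JK mB ->]]].
elim: J {uJ} JK => [|j J ih] JK.
  by rewrite [X in measurable X](_ : _ = setT)//; apply/seteqP; split.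
rewrite [X in measurable X](_ : _ =
    X j @^-1` B j `&` [set w | forall j, j \in J -> B j (X j w)]); last first.
  apply/seteqP; split => w /=.
    move=> h; split; first by apply: h; rewrite mem_head.
    by move=> i iJ; apply: h; rewrite inE iJ orbT.
  by move=> [h1 h2] i; rewrite inE => /orP[/eqP ->|/h2].
apply: measurableI; last first.
  by apply: ih => i iJ; apply: JK; rewrite inE iJ orbT.
by rewrite -[X in measurable X]setTI; apply: mX => //; apply: JK; rewrite mem_head.
Qed.

(* A function is measurable on [gen_type K] when it depends measurably on the
   variables [X j] with [j] in [K] only, so that independence of disjoint blocks
   becomes Fubini on [gen_type K1 * gen_type K2]. *)
Definition gen_type (K : set I) := g_sigma_algebraType (cylinders K).

Lemma measurable_gen_type K j : K j ->
  measurable_fun setT (X j : gen_type K -> R).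
Proof.
move=> Kj _ B mB; rewrite setTI; apply: sub_sigma_algebra.
exact: cylinders_preimage.
Qed.

Lemma measurable_id_gen_type K : (forall j, K j -> measurable_fun setT (X j)) ->
  measurable_fun setT (id : Omega -> gen_type K).
Proof.
move=> mX _ B mB; rewrite setTI preimage_id.
have : <<s cylinders K >> `<=` @measurable _ Omega.
  by apply: smallest_sub; [exact: sigma_algebra_measurable|exact: cylinders_measurable].
exact.
Qed.

Variables (P : probability Omega R) (V : set I).
Hypothesis mX : forall j, V j -> measurable_fun setT (X j).
Hypothesis indepX : forall (J : seq I) (B : I -> set R),
    uniq J -> (forall j, j \in J -> V j) -> (forall j, measurable (B j)) ->
    P [set w | forall j, j \in J -> B j (X j w)] =
      (\prod_(j <- J) fine (P (X j @^-1` B j)))%:E.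

(** Disjointness of [K1] and [K2] keeps [J1 ++ J2] free of repetitions, so one instance of [indepX]
    gives the joint event, and its product splits. *)
Lemma cylinders_indep K1 K2 A B : K1 `<=` V -> K2 `<=` V -> K1 `&` K2 `<=` set0 ->
  cylinders K1 A -> cylinders K2 B -> P (A `&` B) = (P A * P B)%E.
Proof.
move=> V1 V2 K12 [J1 [B1 [u1 h1 m1 ->]]] [J2 [B2 [u2 h2 m2 ->]]].
have J12 j : j \in J2 -> j \in J1 = false.
  by move=> /h2 j2; apply/negP => /h1 j1; have := K12 j (conj j1 j2).
have u12 : uniq (J1 ++ J2).
  rewrite cat_uniq u1 u2 andbT; apply/hasPn => j /J12; by rewrite /= => ->.
have -> : [set w | forall j, j \in J1 -> B1 j (X j w)] `&`
          [set w | forall j, j \in J2 -> B2 j (X j w)] =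
  [set w | forall j, j \in J1 ++ J2 -> (if j \in J1 then B1 j else B2 j) (X j w)].
  apply/seteqP; split => w /=.
    move=> [a1 a2] j; rewrite mem_cat; case: ifP => [jJ _|_ /= jJ]; first exact: a1.
    exact: a2.
  move=> h; split => j jJ; first by have := h j; rewrite mem_cat jJ; exact.
  by have := h j; rewrite mem_cat jJ J12// orbT; exact.
rewrite (indepX (B := fun j => if j \in J1 then B1 j else B2 j) u12); last 2 first.
- by move=> j; rewrite mem_cat => /orP[/h1/V1|/h2/V2].
- by move=> j; case: ifP.
rewrite (indepX u1 _ m1); last by move=> j jJ; apply: V1; exact: h1.
rewrite (indepX u2 _ m2); last by move=> j jJ; apply: V2; exact: h2.
rewrite big_cat/= EFinM; congr (_%:E * _%:E)%E; apply: eq_big_seq => j jJ.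
  by rewrite jJ.
by rewrite J12.
Qed.

(** [indep_sigma_algebra] is used twice, once in each argument with the other event held fixed. *)
Lemma gen_type_indep K1 K2 A B : K1 `<=` V -> K2 `<=` V -> K1 `&` K2 `<=` set0 ->
  <<s cylinders K1 >> A -> <<s cylinders K2 >> B -> P (A `&` B) = (P A * P B)%E.
Proof.
move=> V1 V2 K12 sA sB.
have mK K : K `<=` V -> cylinders K `<=` measurable.
  by move=> KV; apply: cylinders_measurable => j /KV; exact: mX.
have mB : measurable B.
  have := @measurable_id_gen_type K2 (fun j Kj => mX (V2 _ Kj)) measurableT B sB.
  by rewrite setTI.
apply: (indep_sigma_algebra mB (mK _ V1)) sA => //.
- exact: cylindersI.
- exact: cylindersT.
- move=> C cC; rewrite setIC muleC.
  have mC := mK _ V1 _ cC.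
  apply: (indep_sigma_algebra mC (mK _ V2)) sB => //.
  + exact: cylindersI.
  + exact: cylindersT.
  + by move=> D cD; apply: (@cylinders_indep K2 K1) => //; rewrite setIC.
Qed.

(** On the left one sample point fills both slots; since the slots see disjoint blocks of variables,
    they can be decoupled. *)
Lemma gen_type_fubini K1 K2 (f : gen_type K1 * gen_type K2 -> \bar R) :
  K1 `<=` V -> K2 `<=` V -> K1 `&` K2 `<=` set0 ->
  measurable_fun setT f -> (forall z, 0 <= f z)%E ->
  (\int[P]_w f (w, w) = \int[P]_w \int[P]_v f (v, w))%E.
Proof.
move=> V1 V2 K12 mf f0.
apply: (@indep_fubini _ _ _ P _ _ _ _ (id : Omega -> gen_type K1)
  (id : Omega -> gen_type K2)) => //.
- by apply: measurable_id_gen_type => j /V1; exact: mX.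
- by apply: measurable_id_gen_type => j /V2; exact: mX.
- by move=> B C mB mC; exact: (gen_type_indep V1 V2 K12).
Qed.

Lemma gen_type_fubini1 (i : I) K2 (f : R * gen_type K2 -> \bar R) :
  V i -> K2 `<=` V -> ~ K2 i ->
  measurable_fun setT f -> (forall z, 0 <= f z)%E ->
  (\int[P]_w f (X i w, w) = \int[P]_w \int[P]_v f (X i v, w))%E.
Proof.
move=> Vi V2 Ki mf f0.
have V1 : [set i] `<=` V by move=> _ ->.
apply: (@gen_type_fubini [set i] K2 (fun z => f (X i z.1, z.2))) => //.
- by move=> _ [-> /Ki].
- apply: measurableT_comp => //; apply: measurable_fun_pair => //.
  apply: (@measurableT_comp _ _ _ _ _ _ (X i : gen_type [set i] -> R)) => //.
  exact: measurable_gen_type.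
Qed.

End Cylinders.

(** * Densities and exponential laws *)

Section LebesgueDensity.
Context {R : realType}.
Notation mu := (@lebesgue_measure R).
Local Open Scope ereal_scope.

Lemma ge0_integral_reflect (c : R) (f : R -> \bar R) :
  measurable_fun setT f -> (forall x, 0 <= f x) ->
  \int[mu]_x f (c - x)%R = \int[mu]_x f x.
Proof.
move=> mf f0.
have mphi : measurable_fun setT (fun x : R => (c - x)%R : measurableTypeR R).
  by apply: measurable_funB => //; exact: measurable_cst.
pose phi : {mfun R >-> measurableTypeR R} :=
  HB.pack (fun x : R => (c - x)%R) (isMeasurableFun.Build _ _ _ _ _ mphi).
transitivity (\int[pushforward mu phi]_x f x).
  by rewrite ge0_integral_pushforward.
apply: eq_measure_integral => //= A mA _; apply/esym/lebesgue_measure_unique => //.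
move=> _ [[a b]] _ <-; rewrite /= /pushforward.
(* Lebesgue measure is determined by the intervals []a, b]]; their preimages are half-open on the
   other side, with the same length. *)
rewrite (_ : _ @^-1` _ = `[(c - b)%R, (c - a)%R[%classic); last first.
  apply/seteqP; split => x; rewrite /= !in_itv/= => /andP[h1 h2]; apply/andP; split; lra.
rewrite !lebesgue_measure_itv/= !lte_fin ltrD2l ltrN2; case: ifP => // _.
rewrite -!EFinB; congr EFin; ring.
Qed.

(** A translation is the composition of two reflections. *)
Lemma ge0_integral_translate (c : R) (f : R -> \bar R) :
  measurable_fun setT f -> (forall x, 0 <= f x) ->
  \int[mu]_x f (x + c)%R = \int[mu]_x f x.
Proof.
move=> mf f0; rewrite -(ge0_integral_reflect c mf f0).
rewrite -(@ge0_integral_reflect 0%R (fun x => f (x + c)%R))//.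
  by apply: eq_integral => x _; rewrite sub0r addrC.
by apply: measurableT_comp => //; apply: measurable_funD => //; exact: measurable_cst.
Qed.

(** [h] and the Radon-Nikodym derivative of the law of [X] have equal integrals over measurable
    sets, so they agree almost everywhere, and the change of variables for the latter carries
    over. *)
Lemma integral_density d (Omega : measurableType d) (P : probability Omega R)
    (X : Omega -> R) (h : R -> R) (f : R -> \bar R) :
  measurable_fun setT X -> measurable_fun setT h -> (forall x, (0 <= h x)%R) ->
  (forall B, measurable B -> P (X @^-1` B) = \int[mu]_(x in B) (h x)%:E) ->
  measurable_fun setT f -> (forall x, 0 <= f x) ->
  \int[P]_w f (X w) = \int[mu]_x (f x * (h x)%:E).
Proof.
move=> mX mh h0 PX mf f0.
pose X' : {mfun Omega >-> measurableTypeR R} :=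
  HB.pack X (isMeasurableFun.Build _ _ _ (measurableTypeR R) _ mX).
rewrite -[LHS](@ge0_integral_distribution _ _ _ _ _ P X' f)//.
have dom : distribution P X' `<< mu.
  apply/null_content_dominatesP => A mA muA0.
  rewrite /distribution /pushforward /= PX//.
  transitivity (\int[mu]_(x in A) `|(h x)%:E|).
    by apply: eq_integral => x _; rewrite gee0_abs// lee_fin.
  by apply: integral_abs_eq0 => //; apply/measurable_EFinP; exact: measurable_funTS.
rewrite -(Radon_Nikodym_SigmaFinite.change_of_variables dom f0)//.
have fi := Radon_Nikodym_SigmaFinite.f_integrable dom.
apply: ge0_ae_eq_integral => //.
- by apply: emeasurable_funM => //; exact: (measurable_int _ fi).
- by apply: emeasurable_funM => //; exact/measurable_EFinP.
- by move=> x _; rewrite mule_ge0// Radon_Nikodym_SigmaFinite.f_ge0.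
- by move=> x _; rewrite mule_ge0// lee_fin.
- apply: ae_eqe_mul2l; apply: integral_ae_eq => //; first exact/measurable_EFinP.
  by move=> E _ mE; rewrite -Radon_Nikodym_SigmaFinite.f_integral//; exact: PX.
Qed.

Lemma measurable_exponential_pdf_comp d (T : measurableType d) r (f : T -> R) :
  measurable_fun setT f -> measurable_fun setT (fun x => exponential_pdf r (f x)).
Proof. by move=> mf; apply: measurableT_comp => //; exact: measurable_exponential_pdf. Qed.

Lemma exponential_pdf_le (r x : R) : (0 <= r)%R -> (exponential_pdf r x <= r)%R.
Proof.
move=> r0; have [x0|x0] := leP 0%R x; last by rewrite lt0_exponential_pdf.
rewrite exponential_pdfE// ler_piMr// -[leRHS]expR0 ler_expR; nra.
Qed.

End LebesgueDensity.

(** * Exchanging two exponential clocks *)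

Section ExponentialConvolution.
Context {R : realType}.
Notation mu := (@lebesgue_measure R).
Local Open Scope ereal_scope.

(* Differs from [exponential_pdf] only at [0], where it vanishes. *)
Definition open_exponential_pdf (r x : R) : R :=
  if (0 < x)%R then (r * expR (- r * x))%R else 0%R.

Lemma open_exponential_pdf_ge0 r x : (0 <= r)%R -> (0 <= open_exponential_pdf r x)%R.
Proof. by move=> r0; rewrite /open_exponential_pdf; case: ifP => // _; rewrite mulr_ge0// expR_ge0. Qed.

Lemma measurable_open_exponential_pdf r :
  measurable_fun setT (open_exponential_pdf r).
Proof.
apply: measurable_fun_ifT; first by apply: measurable_fun_ltr => //; exact: measurable_cst.
  apply: measurable_funM; first exact: measurable_cst.
  by apply: measurableT_comp => //; apply: measurable_funM => //; exact: measurable_cst.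
exact: measurable_cst.
Qed.

(* Memorylessness: translating by [c] multiplies the density by [expR (- r * c)]. *)
Lemma exponential_tail (r c : R) : (0 < r)%R -> (0 <= c)%R ->
  \int[mu]_x ((if (c <= x)%R then 1 else 0)%:E * (exponential_pdf r x)%:E) =
  (expR (- r * c))%:E.
Proof.
move=> r0 c0.
have mpdf := @measurable_exponential_pdf R r.
rewrite -(@ge0_integral_translate _ c); last 2 first.
- apply: emeasurable_funM; apply/measurable_EFinP => //.
  apply: measurable_fun_ifT; try exact: measurable_cst.
  by apply: measurable_fun_ler => //; exact: measurable_cst.
- by move=> x; rewrite mule_ge0// lee_fin; [case: ifP|exact/exponential_pdf_ge0/ltW].
transitivity (\int[mu]_x ((expR (- r * c))%:E * (exponential_pdf r x)%:E)).
  apply: eq_integral => x _; rewrite lerDr; case: ifPn => [x0|].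
    rewrite mul1e !exponential_pdfE ?addr_ge0// -EFinM mulrCA -expRD.
    by rewrite mulrDr [in RHS]addrC.
  by rewrite -ltNge => x0; rewrite mul0e lt0_exponential_pdf// mule0.
rewrite ge0_integralZl ?lee_fin ?expR_ge0//; last 2 first.
- exact/measurable_EFinP.
- by move=> x _; rewrite lee_fin exponential_pdf_ge0 ?ltW.
by rewrite integral_exponential_pdf// mule1.
Qed.

(** Reflecting [x] to [c - x] exchanges the two densities; the integrands then differ at most at the
    null point [0]. *)
Lemma exponential_convolution (r q c z : R) : (0 < r)%R -> (0 < q)%R -> (0 <= z)%R ->
  \int[mu]_x ((open_exponential_pdf q (c - x) * z)%:E * (exponential_pdf r x)%:E) =
  \int[mu]_x ((exponential_pdf r (c - x) * z)%:E * (exponential_pdf q x)%:E).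
Proof.
move=> r0 q0 z0.
have mc : measurable_fun [set: R] (fun x : R => c - x)%R.
  by apply: measurable_funB => //; exact: measurable_cst.
have mL : measurable_fun setT (fun x : R =>
    (open_exponential_pdf q (c - x) * z)%:E * (exponential_pdf r x)%:E).
  apply: emeasurable_funM; apply/measurable_EFinP; last exact: measurable_exponential_pdf.
  apply: measurable_funM; last exact: measurable_cst.
  by apply: measurableT_comp => //; exact: measurable_open_exponential_pdf.
have ge0 (f h : R -> R) x : (forall x, 0 <= f x)%R -> (forall x, 0 <= h x)%R ->
    0 <= (f x * z)%:E * (h x)%:E.
  by move=> f0 h0; rewrite mule_ge0// lee_fin// mulr_ge0.
have pdf0 s x : (0 < s)%R -> (0 <= exponential_pdf s x)%R.
  by move=> s0; apply: exponential_pdf_ge0; exact: ltW.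
have open0 x : (0 <= open_exponential_pdf q x)%R.
  exact: open_exponential_pdf_ge0 (ltW q0).
rewrite -[LHS](ge0_integral_reflect c mL); last first.
  by move=> x; apply: (@ge0 (fun x => open_exponential_pdf q (c - x)%R)) => y; auto.
apply: ge0_ae_eq_integral => //.
- exact: (measurableT_comp mL mc).
- apply: emeasurable_funM; apply/measurable_EFinP; last exact: measurable_exponential_pdf.
  apply: measurable_funM; last exact: measurable_cst.
  exact: measurable_exponential_pdf_comp.
- move=> x _; apply: (@ge0 (fun x => open_exponential_pdf q (c - (c - x))%R)
    (fun x => exponential_pdf r (c - x)%R)) => y; auto.
- by move=> x _; apply: (@ge0 (fun x => exponential_pdf r (c - x)%R)) => y; auto.
- exists [set 0%R]; split; [exact: measurable_set1|exact: lebesgue_measure_set1|].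
  apply: subsetCl => x /= x0 _; rewrite subKr -!EFinM; congr EFin.
  rewrite /open_exponential_pdf; case: ifPn => [x_gt0|].
    by rewrite (exponential_pdfE _ (ltW x_gt0)); ring.
  rewrite -leNgt le_eqVlt => /orP[/eqP //|xlt].
  by rewrite (lt0_exponential_pdf _ xlt); ring.
Qed.

End ExponentialConvolution.

Lemma measurable_gen_type_sub {R : realType} {d : measure_display}
    {Omega : measurableType d} (I : eqType) (X : I -> Omega -> R) (K L : set I)
    d' (T : measurableType d') (f : Omega -> T) : K `<=` L ->
  measurable_fun setT (f : gen_type X K -> T) ->
  measurable_fun setT (f : gen_type X L -> T).
Proof.
move=> KL mf _ B mB; have := mf measurableT B mB; apply: sub_sigma_algebra2.
by move=> _ [J [C [uJ JK mC ->]]]; exists J, C; split => // j /JK /KL.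
Qed.

(** * Sojourn times and explosion times *)

Section Sojourn.
Context {R : realType} {d : measure_display} {Omega : measurableType d}.
Variables (P : probability Omega R) (A : nat) (F : 'I_A -> nat -> R)
  (X0 : 'I_A -> nat) (t : 'I_A -> nat -> Omega -> R).
Hypothesis X0_gt0 : forall i, (0 < X0 i)%N.
Hypothesis F_gt0 : forall i k, (0 < k)%N -> 0 < F i k.
Hypothesis t0 : forall i k w, 0 <= t i k w.
Hypothesis mt : forall i k, measurable_fun setT (t i k).
Hypothesis t_law : forall i k, (X0 i <= k)%N -> forall B : set R, measurable B ->
  P (t i k @^-1` B) = exponential_prob (F i k) B.
Hypothesis t_indep : sojourn_independent P X0 t.

Definition valid : set ('I_A * nat) := [set j | (X0 j.1 <= j.2)%N].
Definition clock (j : 'I_A * nat) : Omega -> R := t j.1 j.2.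
Definition others (i : 'I_A) : set ('I_A * nat) := [set j | valid j /\ j.1 != i].
(* [psum i (X0 i) x] is [sigma_i(x)], and [tail i (X0 i)] is the explosion time [T_i] *)
Definition psum i m n w : R := \sum_(m <= l < n) t i l w.
Definition tail i m w : \bar R := (\sum_(m <= l <oo) (t i l w)%:E)%E.
Definition rho i w : R := fine (tail i (X0 i).+1 w).
(** This is [S] when [I] consists of the first [a] agents, [S_i] when [I] is the singleton of [i],
    and [T*] when [I] is empty, so that a single limit theorem serves the numerator and the
    denominator. *)
Definition rest (I : {set 'I_A}) w : \bar R :=
  (\big[mine/+oo]_(j | j \notin I) tail j (X0 j) w)%E.
Definition rtime I w : R := fine (rest I w).

Lemma F0 i k : (X0 i <= k)%N -> 0 < F i k.
Proof. by move=> ik; apply: F_gt0; exact: leq_trans (X0_gt0 i) ik. Qed.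

Lemma mclock j : valid j -> measurable_fun setT (clock j).
Proof. by move=> _; exact: mt. Qed.

Lemma measurable_clocks d' (T : measurableType d') (f : Omega -> T) K :
  measurable_fun setT (f : gen_type clock K -> T) -> measurable_fun setT f.
Proof.
move=> mf; apply: (measurableT_comp mf).
by apply: measurable_id_gen_type => j _; exact: mt.
Qed.

Lemma measurable_psum (K : set ('I_A * nat)) i m n :
  (forall l, (m <= l < n)%N -> K (i, l)) ->
  measurable_fun setT (psum i m n : gen_type clock K -> R).
Proof.
move=> mK.
(* Out-of-range indices are given the constant 0, since [t i l] need not be measurable on
   [gen_type clock K] there. *)
rewrite (_ : psum i m n =
    fun w => \sum_(l <- index_iota m n) (if (m <= l < n)%N then t i l w else 0)).
  apply: measurable_sum => l; case: (boolP (m <= l < n)%N) => [/mK Kl|_]; last exact: measurable_cst.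
  exact: (@measurable_gen_type _ _ _ _ clock K (i, l) Kl).
by apply/funext => w; apply: eq_big_nat => l ->.
Qed.

Lemma tail_ge0 i m w : (0 <= tail i m w)%E.
Proof. by apply: nneseries_ge0 => l _ _; rewrite lee_fin. Qed.

Lemma measurable_tail (K : set ('I_A * nat)) i m :
  (forall l, (m <= l)%N -> K (i, l)) ->
  measurable_fun setT (tail i m : gen_type clock K -> \bar R).
Proof.
move=> mK; rewrite (_ : tail i m =
    fun w => (\sum_(l <oo | l \in (fun l => (m <= l)%N)) (t i l w)%:E)%E).
  apply: ge0_emeasurable_sum => [l w _ _|l /mK Kl]; first by rewrite lee_fin.
  have h := @measurable_gen_type _ _ _ _ clock K (i, l) Kl.
  exact: (measurableT_comp (@EFin_measurable R setT) h).
by apply/funext => w; rewrite /tail ereal_series.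
Qed.

Lemma tail_split i m n w : (m <= n)%N ->
  tail i m w = ((psum i m n w)%:E + tail i n w)%E.
Proof.
move=> mn; rewrite /tail (@nneseries_split _ _ m (n - m)); last first.
  by move=> k _; rewrite lee_fin.
by rewrite subnKC// /psum sumEFin.
Qed.

Lemma tail_recl i m w : tail i m w = ((t i m w)%:E + tail i m.+1 w)%E.
Proof. by rewrite (@tail_split i m m.+1)// /psum big_nat1. Qed.

Lemma cvg_psum_tail i m w : (psum i m n w)%:E @[n --> \oo] --> tail i m w.
Proof.
rewrite [X in X @ _ --> _](_ : _ = fun n => (\sum_(m <= l < n) (t i l w)%:E)%E).
  by apply: is_cvg_nneseries => l _ _; rewrite lee_fin.
by apply/funext => n; rewrite /psum sumEFin.
Qed.

Lemma measurable_rho (K : set ('I_A * nat)) i :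
  (forall l, (X0 i < l)%N -> K (i, l)) ->
  measurable_fun setT (rho i : gen_type clock K -> R).
Proof. by move=> mK; apply: measurableT_comp => //; exact: measurable_tail. Qed.

Lemma measurable_rest (K : set ('I_A * nat)) (I : {set 'I_A}) :
  (forall j, valid j -> j.1 \notin I -> K j) ->
  measurable_fun setT (rest I : gen_type clock K -> \bar R).
Proof.
move=> mK; rewrite /rest.
rewrite (_ : (fun w => _) = fun w => \big[mine/+oo%E]_(j <- [seq j <- index_enum 'I_A | j \notin I]) tail j (X0 j) w); last first.
  by apply/funext => w; rewrite big_filter.
have : all (fun j => j \notin I) [seq j <- index_enum 'I_A | j \notin I].
  exact: filter_all.
elim: [seq j <- index_enum 'I_A | j \notin I] => [|j s ih] /=.
  by move=> _; under eq_fun do rewrite big_nil; exact: measurable_cst.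
move=> /andP[jI /ih ms]; under eq_fun do rewrite big_cons.
apply: measurable_mine => //; apply: measurable_tail => l jl; exact: mK.
Qed.

Lemma measurable_rtime (K : set ('I_A * nat)) (I : {set 'I_A}) :
  (forall j, valid j -> j.1 \notin I -> K j) ->
  measurable_fun setT (rtime I : gen_type clock K -> R).
Proof. by move=> mK; apply: measurableT_comp => //; exact: measurable_rest. Qed.

Lemma expectation_law (i : 'I_A) k (f : R -> \bar R) : (X0 i <= k)%N ->
  measurable_fun setT f -> (forall x, 0 <= f x)%E ->
  (\int[P]_w f (t i k w) =
   \int[lebesgue_measure]_x (f x * (exponential_pdf (F i k) x)%:E))%E.
Proof.
move=> ik mf f0; apply: integral_density => //.
- exact: measurable_exponential_pdf.
- by move=> x; apply: exponential_pdf_ge0; exact/ltW/F0.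
- by move=> B mB; rewrite t_law.
Qed.

Lemma fubini_clocks K1 K2 (f : gen_type clock K1 * gen_type clock K2 -> \bar R) :
  K1 `<=` valid -> K2 `<=` valid -> K1 `&` K2 `<=` set0 ->
  measurable_fun setT f -> (forall z, 0 <= f z)%E ->
  (\int[P]_w f (w, w) = \int[P]_w \int[P]_v f (v, w))%E.
Proof. exact: (gen_type_fubini mclock t_indep). Qed.

Lemma fubini_clock (j : 'I_A * nat) K (f : R * gen_type clock K -> \bar R) :
  valid j -> K `<=` valid -> ~ K j ->
  measurable_fun setT f -> (forall z, 0 <= f z)%E ->
  (\int[P]_w f (clock j w, w) = \int[P]_w
    \int[lebesgue_measure]_x (f (x, w) * (exponential_pdf (F j.1 j.2) x)%:E))%E.
Proof.
move=> Vj VK Kj mf f0.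
rewrite (gen_type_fubini1 mclock t_indep Vj VK Kj mf f0); apply: eq_integral => w _.
apply: (@expectation_law j.1 j.2 (fun x => f (x, w))) => //.
exact: (measurable_fun_pair1 (w : gen_type clock K) mf).
Qed.

(* The factors are replaced one agent at a time, the other factors being
   absorbed into [Z], a function of the clocks of the other agents. *)
Lemma prod_replace (I : {set 'I_A}) (a b : 'I_A -> Omega -> R) (Y : Omega -> R) :
  (forall i w, i \in I -> 0 <= a i w) -> (forall i w, i \in I -> 0 <= b i w) ->
  (forall w, 0 <= Y w) ->
  (forall i, i \in I -> measurable_fun setT
    (a i : gen_type clock [set j | valid j /\ (j.1 = i \/ j.1 \notin I)] -> R)) ->
  (forall i, i \in I -> measurable_fun setT
    (b i : gen_type clock [set j | valid j /\ (j.1 = i \/ j.1 \notin I)] -> R)) ->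
  measurable_fun setT (Y : gen_type clock [set j | valid j /\ j.1 \notin I] -> R) ->
  (forall i, i \in I -> forall Z : Omega -> R,
    measurable_fun setT (Z : gen_type clock (others i) -> R) ->
    (forall w, 0 <= Z w) ->
    (\int[P]_w (a i w * Z w)%:E = \int[P]_w (b i w * Z w)%:E)%E) ->
  (\int[P]_w (Y w * \prod_(i in I) a i w)%:E =
   \int[P]_w (Y w * \prod_(i in I) b i w)%:E)%E.
Proof.
move=> a0 b0 Y0 ma mb mY ab.
have prod_ge0 s w (f : 'I_A -> Omega -> R) : {subset s <= I} ->
    (forall i w, i \in I -> 0 <= f i w) -> 0 <= \prod_(i <- s) f i w.
  by move=> sI f0; rewrite big_seq; apply: prodr_ge0 => i /sI; exact: f0.
suff H s : uniq s -> {subset s <= I} -> forall Z : Omega -> R, (forall w, 0 <= Z w) ->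
    measurable_fun setT (Z : gen_type clock [set j | valid j /\ j.1 \notin s] -> R) ->
    (\int[P]_w (Z w * \prod_(i <- s) a i w)%:E =
     \int[P]_w (Z w * \prod_(i <- s) b i w)%:E)%E.
  have E (f : 'I_A -> Omega -> R) : (\int[P]_w (Y w * \prod_(i in I) f i w)%:E =
      \int[P]_w (Y w * \prod_(i <- enum I) f i w)%:E)%E.
    by apply: eq_integral => w _; rewrite big_enum.
  rewrite !E; apply: H => //; first exact: enum_uniq.
    by move=> i; rewrite mem_enum.
  apply: measurable_gen_type_sub mY => j [vj jI]; split => //.
  by rewrite mem_enum.
elim: s => [|i s ih] /=.
  by move=> _ _ Z _ _; apply: eq_integral => w _; rewrite !big_nil.
move=> /andP[si us] sI Z Z0 mZ.
have iI : i \in I by apply: sI; rewrite mem_head.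
have sI' : {subset s <= I} by move=> j js; apply: sI; rewrite inE js orbT.
transitivity (\int[P]_w (a i w * (Z w * \prod_(i <- s) a i w))%:E)%E.
  by apply: eq_integral => w _; rewrite big_cons; congr EFin; ring.
rewrite ab//; last 2 first.
- apply: measurable_funM.
    apply: measurable_gen_type_sub mZ => j [vj]; rewrite inE negb_or => /andP[ji _].
    by split.
  apply: measurable_prod => k ks; apply: measurable_gen_type_sub (ma _ (sI' _ ks)).
  move=> j [vj jk]; split => //; apply: contraNneq si => ji.
  by case: jk => [jk|]; [rewrite -ji jk|rewrite ji iI].
- by move=> w; rewrite mulr_ge0// prod_ge0.
(* The new factor [b i] joins [Z]: it uses clocks of [i] or of agents outside [I], none of which
   belongs to the remaining list. *)
transitivity (\int[P]_w ((Z w * b i w) * \prod_(i <- s) a i w)%:E)%E.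
  by apply: eq_integral => w _; congr EFin; ring.
rewrite ih//.
- by apply: eq_integral => w _; rewrite big_cons; congr EFin; ring.
- by move=> w; rewrite mulr_ge0// b0.
- apply: measurable_funM.
    apply: measurable_gen_type_sub mZ => j [vj]; rewrite inE negb_or => /andP[_ js].
    by split.
  apply: measurable_gen_type_sub (mb _ iI) => j [vj ji]; split => //.
  by case: ji => [->//|]; apply: contra => /sI'.
Qed.

Lemma measurable_gen_type_snd (K L : set ('I_A * nat)) d' (T : measurableType d')
    (f : Omega -> T) : K `<=` L ->
  measurable_fun setT (f : gen_type clock K -> T) ->
  measurable_fun setT (fun z : R * gen_type clock L => f z.2).
Proof.
move=> KL mf; apply: (@measurableT_comp _ _ _ _ _ _ (f : gen_type clock L -> T)) => //.
exact: measurable_gen_type_sub mf.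
Qed.

Lemma psum_recl i m n w : (m < n)%N -> psum i m n w = t i m w + psum i m.+1 n w.
Proof. by move=> mn; rewrite /psum big_ltn. Qed.

Lemma psum_recr i m n w : (m <= n)%N -> psum i m n.+1 w = psum i m n w + t i n w.
Proof. by move=> mn; rewrite /psum big_nat_recr. Qed.

(* Integrating out the clock [x] leaves the density of that clock at
   [s - sigma_i(x)]; reflecting the integral over the clock [X0 i] then moves
   the density to the clock [X0 i], whose rate does not depend on [x]. *)
Lemma window_identity i x (s Z : Omega -> R) : (X0 i < x)%N ->
  measurable_fun setT (s : gen_type clock (others i) -> R) ->
  measurable_fun setT (Z : gen_type clock (others i) -> R) ->
  (forall w, 0 <= Z w) ->
  (\int[P]_w ((if psum i (X0 i) x w < s w <= psum i (X0 i) x.+1 w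
               then F i x else 0) * Z w)%:E =
   \int[P]_w (exponential_pdf (F i (X0 i)) (s w - psum i (X0 i).+1 x.+1 w) * Z w)%:E)%E.
Proof.
move=> ix ms mZ Z0.
have Fx : 0 < F i x by apply: F0; exact: ltnW.
have FX : 0 < F i (X0 i) by exact: F0.
pose Kx := [set j | valid j /\ j <> (i, x)].
pose KX := [set j | valid j /\ j <> (i, X0 i)].
have vx : valid (i, x) by rewrite /valid /= ltnW.
have vX : valid (i, X0 i) by rewrite /valid /=.
have sub y : others i `<=` [set j | valid j /\ j <> (i, y)].
  by move=> j [vj ji]; split=> // jE; rewrite jE eqxx in ji.
have mps n m (K := [set j | valid j /\ j <> (i, x)]) : (X0 i <= n)%N -> (m <= x)%N ->
    measurable_fun setT (psum i n m : gen_type clock K -> R).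
  move=> Xn mx; apply: measurable_psum => l /andP[nl lm]; split.
    by rewrite /valid /= (leq_trans Xn nl).
  by move=> [lx]; rewrite lx ltnNge mx in lm.
have mpX m : measurable_fun setT (psum i (X0 i).+1 m : gen_type clock KX -> R).
  apply: measurable_psum => l /andP[nl lm]; split.
    by rewrite /valid /= ltnW.
  by move=> [lx]; rewrite lx ltnn in nl.
(* Given the other clocks, the window asks [t i x] to be at least [s - sigma_i(x)], a positive
   number. The factor [F i x] turns this tail probability into a density, open at 0 because the
   lower inequality is strict. *)
transitivity (\int[P]_w (open_exponential_pdf (F i x) (s w - psum i (X0 i) x w) * Z w)%:E)%E.
  pose f (z : R * gen_type clock Kx) := ((if psum i (X0 i) x z.2 < s z.2 <=
    psum i (X0 i) x z.2 + z.1 then F i x else 0) * Z z.2)%:E.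
  transitivity (\int[P]_w f (clock (i, x) w, w))%E.
    by apply: eq_integral => w _; rewrite /f /clock /= psum_recr// ltnW.
  rewrite (@fubini_clock (i, x) Kx f) => //; first last.
  - move=> z; rewrite lee_fin mulr_ge0//; case: ifP => // _; exact: ltW.
  - apply/measurable_EFinP; apply: measurable_funM; last exact: (measurable_gen_type_snd (sub _) mZ).
    apply: measurable_fun_ifT; try exact: measurable_cst.
    have mp := measurable_gen_type_snd (@subset_refl _ Kx) (mps _ _ (leqnn _) (leqnn x)).
    have ms' := measurable_gen_type_snd (sub x) ms.
    apply: measurable_and; first exact: measurable_fun_ltr.
    apply: measurable_fun_ler => //; exact: measurable_funD.
  - by move=> [].
  - by move=> j [].
  apply: eq_integral => w _; rewrite /f /=.
  rewrite /open_exponential_pdf subr_gt0; case: ifPn => [ps|/negbTE ps].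
    transitivity (\int[lebesgue_measure]_y ((F i x * Z w)%:E *
      ((if (s w - psum i (X0 i) x w <= y)%R then 1 else 0)%:E *
       (exponential_pdf (F i x) y)%:E)))%E.
      apply: eq_integral => y _; rewrite lerBlDl /=; case: ifP => _.
        by rewrite mul1e.
      by rewrite !mul0r !mul0e mule0.
    have FZ : (0 <= (F i x * Z w)%:E)%E by rewrite lee_fin mulr_ge0// ltW.
    rewrite ge0_integralZl//; last 2 first.
    - apply: emeasurable_funM; apply/measurable_EFinP; last exact: measurable_exponential_pdf.
      apply: measurable_fun_ifT; try exact: measurable_cst.
      by apply: measurable_fun_ler => //; exact: measurable_cst.
    - move=> y _; rewrite mule_ge0// lee_fin; first by case: ifP.
      by apply: exponential_pdf_ge0; exact: ltW.
    rewrite exponential_tail// ?subr_ge0; last exact: ltW.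
    by rewrite -EFinM; congr EFin; ring.
  by rewrite integral0_eq ?mul0r// => y _; rewrite /= mul0r mul0e.
transitivity (\int[P]_w \int[lebesgue_measure]_y
  ((open_exponential_pdf (F i x) (s w - psum i (X0 i).+1 x w - y) * Z w)%:E *
   (exponential_pdf (F i (X0 i)) y)%:E))%E.
  pose f (z : R * gen_type clock KX) := (open_exponential_pdf (F i x)
    (s z.2 - psum i (X0 i).+1 x z.2 - z.1) * Z z.2)%:E.
  transitivity (\int[P]_w f (clock (i, X0 i) w, w))%E.
    apply: eq_integral => w _; rewrite /f /clock /= psum_recl//.
    by rewrite opprD addrA addrAC.
  rewrite (@fubini_clock (i, X0 i) KX f) => //.
  - by move=> j [].
  - by move=> [].
  - apply/measurable_EFinP; apply: measurable_funM; last exact: (measurable_gen_type_snd (sub _) mZ).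
    have mp := measurable_gen_type_snd (@subset_refl _ KX) (mpX x).
    have ms' := measurable_gen_type_snd (sub (X0 i)) ms.
    apply: measurableT_comp; first exact: measurable_open_exponential_pdf.
    by apply: measurable_funB => //; apply: measurable_funB.
  - move=> z; rewrite lee_fin mulr_ge0//; apply: open_exponential_pdf_ge0; exact: ltW.
transitivity (\int[P]_w \int[lebesgue_measure]_y
  ((exponential_pdf (F i (X0 i)) (s w - psum i (X0 i).+1 x w - y) * Z w)%:E *
   (exponential_pdf (F i x) y)%:E))%E.
  by apply: eq_integral => w _; rewrite exponential_convolution.
(* The clock [x] is put back, so that the sum runs from [X0 i + 1] through [x]. *)
pose f (z : R * gen_type clock Kx) := (exponential_pdf (F i (X0 i))
  (s z.2 - psum i (X0 i).+1 x z.2 - z.1) * Z z.2)%:E.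
apply/esym; transitivity (\int[P]_w f (clock (i, x) w, w))%E.
  apply: eq_integral => w _; rewrite /f /clock /= psum_recr//.
  by rewrite opprD addrA.
rewrite (@fubini_clock (i, x) Kx f) => //.
- by move=> j [].
- by move=> [].
- apply/measurable_EFinP; apply: measurable_funM; last exact: (measurable_gen_type_snd (sub _) mZ).
  have mp := measurable_gen_type_snd (@subset_refl _ Kx) (mps _ _ (leqnSn _) (leqnn x)).
  have ms' := measurable_gen_type_snd (sub x) ms.
  apply: measurable_exponential_pdf_comp.
  by apply: measurable_funB => //; apply: measurable_funB.
- move=> z; rewrite lee_fin mulr_ge0//; apply: exponential_pdf_ge0; exact: ltW.
Qed.

(** * Finiteness and smallness of the tails *)

Lemma measurable_tailT i m : measurable_fun setT (tail i m).
Proof. by apply: (@measurable_clocks _ _ _ setT); exact: measurable_tail. Qed.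

(** The mean is [1 / F i k]. A bound of this order is enough for summing over [k], and the constant
    4 comes from comparison with the exponential density of half the rate. *)
Lemma mean_clock_le i k : (X0 i <= k)%N ->
  (\int[P]_w (t i k w)%:E <= (4 * (F i k)^-1)%:E)%E.
Proof.
move=> ik; have Fk := F0 ik; set r := F i k in Fk *.
have r2 : 0 < r / 2 by rewrite divr_gt0.
have mpdf s := @measurable_exponential_pdf R s.
have pdf0 s x : 0 < s -> 0 <= exponential_pdf s x :> R.
  by move=> s0; apply: exponential_pdf_ge0; exact: ltW.
(* [x r e^(-r x) <= (4/r) (r/2) e^(-r x/2)], because [y e^(-y) <= 1] at [y = r x/2] *)
rewrite (eq_integral (fun w => `|t i k w|%:E)); last first.
  by move=> w _; rewrite ger0_norm.
rewrite (@expectation_law i k (fun x => `|x|%:E))//; last first.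
  by apply/measurable_EFinP; exact: normr_measurable.
apply: (@le_trans _ _ (\int[lebesgue_measure]_x
    ((4 * r^-1)%:E * (exponential_pdf (r / 2) x)%:E))%E); last first.
  have c0 : (0 <= (4 * r^-1)%:E)%E by rewrite lee_fin mulr_ge0// invr_ge0 ltW.
  rewrite ge0_integralZl//; last 2 first.
  - by apply/measurable_EFinP; exact: mpdf.
  - by move=> x _; rewrite lee_fin pdf0.
  by rewrite integral_exponential_pdf// mule1.
apply: ge0_le_integral => //.
- by move=> x _; rewrite mule_ge0// lee_fin pdf0.
- apply: emeasurable_funM; apply/measurable_EFinP; last exact: mpdf.
  exact: normr_measurable.
- apply: emeasurable_funM; apply/measurable_EFinP; last exact: mpdf.
  exact: measurable_cst.
- move=> x _; rewrite -!EFinM lee_fin.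
  have [x0|x0] := leP 0 x; last first.
    by rewrite !lt0_exponential_pdf// !mulr0.
  rewrite !exponential_pdfE// ger0_norm//.
  have -> : - r * x = - (r / 2) * x + - (r / 2) * x by field.
  rewrite expRD; set e := expR _.
  have e0 : 0 <= e by exact: expR_ge0.
  have ey : (r / 2 * x) * e <= 1.
    rewrite /e mulNr expRN ler_pdivrMr ?expR_gt0// mul1r.
    by apply: le_trans (expR_ge1Dx _); lra.
  have -> : x * (r * (e * e)) = 2 * e * (r / 2 * x * e) by field.
  have r_neq0 : r != 0 by rewrite gt_eqF.
  have -> : 4 * r^-1 * (r / 2 * e) = 2 * e by field.
  by rewrite ler_piMr// mulr_ge0.
Qed.

(** The test [X0 i <= l] makes [c] nonnegative at every index, including 0, where the sign of [F i]
    is unknown. *)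
Lemma mean_tail_le i m (c := fun l => (if (X0 i <= l)%N then 4 * (F i l)^-1 else 0)%:E) :
  (X0 i <= m)%N -> (\int[P]_w tail i m w <= \sum_(m <= l <oo) c l)%E.
Proof.
move=> im.
have c0 l : (0 <= c l)%E.
  rewrite /c lee_fin; case: ifP => // /F0 Fl.
  by rewrite mulr_ge0// invr_ge0 ltW.
have E w : tail i m w = (\sum_(l <oo) (t i (l + m) w)%:E)%E.
  by rewrite /tail -(@nneseries_addn _ (fun l => (t i l w)%:E))// => l; rewrite lee_fin.
under eq_integral do rewrite E.
rewrite -(nneseries_addn _ c0) (@integral_nneseries _ _ _ P setT measurableT
  (fun l w => (t i (l + m) w)%:E)); last 2 first.
- by move=> n; apply/measurable_EFinP; exact: mt.
- by move=> n w _; rewrite lee_fin.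
apply: lee_nneseries => [l _ _|l _]; first by apply: integral_ge0 => w _; rewrite lee_fin.
rewrite /c; have ilm : (X0 i <= l + m)%N by rewrite (leq_trans im)// leq_addl.
by rewrite ilm; exact: mean_clock_le.
Qed.

Lemma mean_bound_summable i (c := fun l => (if (X0 i <= l)%N then 4 * (F i l)^-1 else 0)%:E) :
  summable_feedback (F i) -> (\sum_(0 <= l <oo) c l < +oo)%E.
Proof.
move=> Fi.
have c0 l : (0 <= c l)%E.
  rewrite /c lee_fin; case: ifP => // /F0 Fl.
  by rewrite mulr_ge0// invr_ge0 ltW.
(* [summable_feedback] sums from 1; the term at 0 vanishes because [0 < X0 i]. *)
rewrite (@nneseries_split _ _ 0 1)// big_nat1 add0n.
rewrite {1}/c leqNgt X0_gt0 add0e ereal_series.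
apply: (@le_lt_trans _ _ (\sum_(l <oo | (1 <= l)%N) (4%:E * ((F i l)^-1)%:E))%E).
  apply: lee_nneseries => // l l0; rewrite /c -EFinM lee_fin; case: ifP => // _.
  by rewrite mulr_ge0// invr_ge0 ltW// F_gt0.
rewrite nneseriesZl; last by move=> l l0; rewrite lee_fin invr_ge0 ltW// F_gt0.
by rewrite -ereal_series lte_mul_pinfty.
Qed.

Lemma mean_tail_lt i (e : R) : summable_feedback (F i) -> 0 < e ->
  exists m, (X0 i <= m)%N /\ (\int[P]_w tail i m w < e%:E)%E.
Proof.
move=> Fi e0.
have := nneseries_tail_cvg (mean_bound_summable Fi).
have c0 l : (0 <= (if (X0 i <= l)%N then 4 * (F i l)^-1 else 0)%:E :> \bar R)%E.
  rewrite lee_fin; case: ifP => // /F0 Fl.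
  by rewrite mulr_ge0// invr_ge0 ltW.
move=> /(_ (fun l _ => c0 l)) /(_ [set x | x < e%:E]%E).
case=> [|N _ /= HN].
  by apply: open_nbhs_nbhs; split; [exact: open_ereal_lt_ereal|rewrite /= lte_fin].
exists (maxn (X0 i) N); split; first exact: leq_maxl.
apply: le_lt_trans (mean_tail_le (leq_maxl _ _)) _.
by apply: HN; rewrite /= leq_maxr.
Qed.

Lemma clock_small_gt0 i k (e : R) : (X0 i <= k)%N -> 0 < e ->
  (0 < P [set w | (t i k w <= e)%R])%E.
Proof.
move=> ik e0; rewrite (_ : [set w | _] = t i k @^-1` `[0, e]); last first.
  by apply/seteqP; split => w /=; rewrite in_itv/= t0.
rewrite t_law// exponential_prob_itv0c// -EFinB lte_fin subr_gt0.
by rewrite -expR0 ltr_expR mulNr oppr_lt0 mulr_gt0// F0.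
Qed.

Lemma indep_gt0 K1 K2 (B C : set Omega) : K1 `<=` valid -> K2 `<=` valid ->
  K1 `&` K2 `<=` set0 ->
  measurable (B : set (gen_type clock K1)) -> measurable (C : set (gen_type clock K2)) ->
  (0 < P B -> 0 < P C -> 0 < P (B `&` C))%E.
Proof.
move=> V1 V2 K12 mB mC B0 C0.
by rewrite (gen_type_indep mclock t_indep V1 V2 K12 mB mC) mule_gt0.
Qed.

Lemma measurable_psum_le K i m n (e : R) :
  (forall l, (m <= l < n)%N -> K (i, l)) ->
  measurable ([set w | psum i m n w <= e] : set (gen_type clock K)).
Proof.
move=> mK; have := @measurable_fun_ler _ (gen_type clock K) R setT _ _
  (measurable_psum mK) (measurable_cst e).
move=> /(_ measurableT [set true]); rewrite setTI; exact.
Qed.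

Lemma measurable_tail_le K i m (e : R) :
  (forall l, (m <= l)%N -> K (i, l)) ->
  measurable ([set w | (tail i m w <= e%:E)%E] : set (gen_type clock K)).
Proof.
move=> mK; rewrite -[X in measurable X]setTI.
by apply: emeasurable_fun_infty_c => //; exact: measurable_tail.
Qed.

Lemma gen_measurable K (B : set Omega) :
  measurable (B : set (gen_type clock K)) -> measurable B.
Proof.
move=> mB; have := @measurable_id_gen_type _ _ _ _ clock K (fun j _ => mt j.1 j.2) measurableT B mB.
by rewrite setTI.
Qed.

Lemma psum_small_gt0 i m n (e : R) : (X0 i <= m)%N -> (m <= n)%N -> 0 < e ->
  (0 < P [set w | (psum i m n w <= e)%R])%E.
Proof.
move=> im mn; rewrite -(subnK mn); elim: (n - m)%N e => [|k ih] e e0.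
  rewrite add0n (_ : [set w | _] = setT) ?probability_setT//.
  by apply/seteqP; split => // w _ /=; rewrite /psum big_geq// ltW.
have e20 : 0 < e / 2 by rewrite divr_gt0.
pose K1 := [set j : 'I_A * nat | j.1 = i /\ (m <= j.2 < k + m)%N].
pose K2 := [set (i, (k + m)%N)].
have m1 : measurable ([set w | psum i m (k + m) w <= e / 2] : set (gen_type clock K1)).
  by apply: measurable_psum_le => l lm; split.
have m2 : measurable ([set w | psum i (k + m) (k + m).+1 w <= e / 2] : set (gen_type clock K2)).
  by apply: measurable_psum_le => l; rewrite ltnS -eqn_leq => /eqP <-.
have ikm : (X0 i <= k + m)%N by rewrite (leq_trans im)// leq_addl.
apply: lt_le_trans (indep_gt0 _ _ _ m1 m2 (ih _ e20) _) _.
- by move=> [j l] /= [/= -> /andP[+ _]]; rewrite /valid /=; exact: leq_trans.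
- by move=> _ ->.
- by move=> [j l] [[/= _ /andP[_ lk]] [_ lE]]; rewrite lE ltnn in lk.
- rewrite (_ : [set w | _] = [set w | t i (k + m) w <= e / 2]); last first.
    by apply/seteqP; split => w /=; rewrite /psum big_nat1.
  exact: clock_small_gt0.
- have K0 : forall l, (m <= l < (k + m).+1)%N -> [set: 'I_A * nat] (i, l) by [].
  apply: le_measure; rewrite ?inE.
  + by apply: measurableI; [exact: gen_measurable m1|exact: gen_measurable m2].
  + exact: gen_measurable (measurable_psum_le _ K0).
  + move=> w /= [h1]; rewrite {1}/psum big_nat1 => h2.
    by rewrite addSn psum_recr ?leq_addl// [leRHS](splitr e) lerD.
Qed.

(** The series is cut at a large [N]. The finite part and the remainder are each at most [e / 2]
    with positive probability, and they use disjoint sets of clocks. *)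
Lemma tail_small_gt0 i m (e : R) : summable_feedback (F i) -> (X0 i <= m)%N -> 0 < e ->
  (0 < P [set w | (tail i m w <= e%:E)%E])%E.
Proof.
move=> Fi im e0; have e20 : 0 < e / 2 by rewrite divr_gt0.
have [N0 [iN0 EN0]] := mean_tail_lt Fi e20.
have mN0 : measurable [set w | (tail i N0 w <= (e / 2)%:E)%E].
  by apply: (@gen_measurable setT); exact: measurable_tail_le.
(* Otherwise the tail would exceed [e / 2] almost surely, contradicting the bound on its mean. *)
have N0_gt0 : (0 < P [set w | (tail i N0 w <= (e / 2)%:E)%E])%E.
  rewrite lt0e measure_ge0 andbT; apply/eqP => P0.
  suff : ((e / 2)%:E <= \int[P]_w tail i N0 w)%E by rewrite leNgt EN0.
  have -> : ((e / 2)%:E = \int[P]_w (cst (e / 2)%:E w))%E.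
    rewrite (integral_cst P measurableT) -[LHS]mule1; congr (_ * _)%E.
    by apply/esym; exact: probability_setT.
  apply: ae_ge0_le_integral => //.
  - by move=> w _; rewrite lee_fin ltW.
  - by move=> w _; exact: tail_ge0.
  - exact: measurable_tailT.
  - exists [set w | (tail i N0 w <= (e / 2)%:E)%E]; split => //.
    by move=> w /= /not_implyP[_ /negP]; rewrite -ltNge => /ltW.
pose N := maxn m N0.
have mN : (m <= N)%N by exact: leq_maxl.
have NN : (N0 <= N)%N by exact: leq_maxr.
pose K1 := [set j : 'I_A * nat | j.1 = i /\ (m <= j.2 < N)%N].
pose K2 := [set j : 'I_A * nat | j.1 = i /\ (N <= j.2)%N].
have m1 : measurable ([set w | psum i m N w <= e / 2] : set (gen_type clock K1)).
  by apply: measurable_psum_le => l lm; split.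
have m2 : measurable ([set w | tail i N w <= (e / 2)%:E]%E : set (gen_type clock K2)).
  by apply: measurable_tail_le => l lm; split.
apply: lt_le_trans (indep_gt0 _ _ _ m1 m2 (psum_small_gt0 im mN e20) _) _.
- by move=> [j l] /= [/= -> /andP[+ _]]; rewrite /valid /=; exact: leq_trans.
- move=> [j l] /= [/= -> +]; rewrite /valid /=; apply: leq_trans.
  exact: leq_trans iN0 NN.
- by move=> [j l] [[/= _ /andP[_ +]] [_ /= +]]; rewrite ltnNge => /negP.
- apply: lt_le_trans N0_gt0 _; apply: le_measure; rewrite ?inE//.
    exact: gen_measurable m2.
  move=> w /=; apply: le_trans; rewrite (tail_split i w NN) leeDr// lee_fin.
  exact: sumr_ge0.
- have K0 : forall l, (m <= l)%N -> [set: 'I_A * nat] (i, l) by [].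
  apply: le_measure; rewrite ?inE.
  + by apply: measurableI; [exact: gen_measurable m1|exact: gen_measurable m2].
  + exact: gen_measurable (measurable_tail_le _ K0).
  + move=> w /= [h1 h2]; rewrite (tail_split i w mN) [e]splitr EFinD leeD//.
Qed.

Lemma ae_foralln (Q : nat -> Omega -> Prop) :
  (forall n, {ae P, forall w, Q n w}) -> {ae P, forall w, forall n, Q n w}.
Proof.
move=> aeQ; have := negligible_bigcup aeQ; apply: negligibleS => w /= nQ.
by apply: contrapT => h; apply: nQ => n; apply: contrapT => nQn; apply: h; exists n.
Qed.

Lemma ae_measure_eq (B C : set Omega) : measurable B -> measurable C ->
  {ae P, forall w, B w <-> C w} -> P B = P C.
Proof.
move=> mB mC BC; rewrite -[B]setIT -[C]setIT -!integral_indic//.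
apply: ge0_ae_eq_integral => //.
- by apply/measurable_EFinP; exact: measurable_indic.
- by apply/measurable_EFinP; exact: measurable_indic.
- apply: filterS BC => w BC _; congr EFin; rewrite !indicE; congr (_%:R); congr nat_of_bool.
  by apply/idP/idP; rewrite !inE => /BC.
Qed.

Lemma ae_clock_gt0 : {ae P, forall w, forall i l, (X0 i <= l)%N -> 0 < t i l w}.
Proof.
apply: filter_forall => i; apply: ae_foralln => l.
have [il|li] := leqP (X0 i) l; last by apply/aeW => w.
have mS : measurable (t i l @^-1` [set 0]) by rewrite -[X in measurable X]setTI; exact: mt.
exists (t i l @^-1` [set 0]); split => //.
  rewrite t_law// /exponential_prob.
  transitivity (\int[lebesgue_measure]_(x in [set 0%R]) `|(exponential_pdf (F i l) x)%:E|)%E.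
    apply: eq_integral => x _; rewrite gee0_abs// lee_fin.
    by apply: exponential_pdf_ge0; rewrite ltW// F0.
  apply: integral_abs_eq0 => //; last exact: lebesgue_measure_set1.
  by apply/measurable_EFinP; apply: measurable_funTS; exact: measurable_exponential_pdf.
by move=> w /= /not_implyP[_ /negP]; rewrite -leNgt => h; apply/eqP; rewrite eq_le h t0.
Qed.

(** Some tail has finite mean, hence is almost surely finite; starting elsewhere changes it by a
    finite sum. *)
Lemma ae_tail_fin i m : summable_feedback (F i) -> (X0 i <= m)%N ->
  {ae P, forall w, (tail i m w < +oo)%E}.
Proof.
move=> Fi im; have [N [iN EN]] := mean_tail_lt Fi (@ltr01 R).
have : P.-integrable setT (tail i N).
  apply/integrableP; split; first exact: measurable_tailT.
  under eq_integral do rewrite gee0_abs ?tail_ge0//.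
  exact: lt_trans EN (ltry _).
move=> /(integrable_ae measurableT); apply: filterS => w /(_ Logic.I).
rewrite ge0_fin_numE ?tail_ge0// => Noo.
have [mN|/ltnW Nm] := leqP m N.
  by rewrite (tail_split i w mN) lte_add_pinfty// ltry.
apply: le_lt_trans Noo; rewrite (tail_split i w Nm) leeDr// lee_fin.
exact: sumr_ge0.
Qed.

Lemma rest_cases (I : {set 'I_A}) w :
  rest I w = +oo%E \/ exists2 j, j \notin I & rest I w = tail j (X0 j) w.
Proof.
rewrite /rest; elim/big_ind: _ => [|x y Hx Hy|j jI]; first by left.
- by rewrite minEle; case: ifP.
- by right; exists j.
Qed.

Lemma rest_ge0 I w : (0 <= rest I w)%E.
Proof. by have [->//|[j _ ->]] := rest_cases I w; exact: tail_ge0. Qed.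

Lemma rest_le (I : {set 'I_A}) j w : j \notin I -> (rest I w <= tail j (X0 j) w)%E.
Proof. by move=> jI; rewrite /rest; exact: bigmin_le_cond. Qed.

(** One summable agent outside [I] suffices for the minimum to be finite; the others may never
    explode. *)
Lemma ae_rest_fin (I : {set 'I_A}) j : j \notin I -> summable_feedback (F j) ->
  {ae P, forall w, rest I w \is a fin_num}.
Proof.
move=> jI Fj; apply: filterS (ae_tail_fin Fj (leqnn _)) => w h.
by rewrite ge0_fin_numE ?rest_ge0//; apply: le_lt_trans h; exact: rest_le.
Qed.

(** * The density of an explosion time *)

Definition shifted_density i (v : R) : \bar R :=
  (\int[P]_w (exponential_pdf (F i (X0 i)) (v - rho i w))%:E)%E.

Definition later i : set ('I_A * nat) := [set j | j.1 = i /\ (X0 i < j.2)%N].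

Lemma later_valid i : later i `<=` valid.
Proof. by move=> [j l] [/= ->]; rewrite /valid /= => /ltnW. Qed.

Lemma measurable_later i : measurable_fun setT (rho i : gen_type clock (later i) -> R).
Proof. by apply: measurable_rho => l il; split. Qed.

Lemma measurable_rhoT i : measurable_fun setT (rho i).
Proof. by apply: (@measurable_clocks _ _ _ (later i)); exact: measurable_later. Qed.

Lemma pdf_ge0 i x : 0 <= exponential_pdf (F i (X0 i)) x.
Proof. by apply: exponential_pdf_ge0; rewrite ltW// F0. Qed.

Lemma measurable_shift_pair i : measurable_fun setT (fun z : Omega * R =>
    (exponential_pdf (F i (X0 i)) (z.2 - rho i z.1))%:E).
Proof.
apply/measurable_EFinP; apply: measurable_exponential_pdf_comp.
apply: measurable_funB; first exact: measurable_snd.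
by apply: measurableT_comp => //; exact: measurable_rhoT.
Qed.

Lemma measurable_shifted_density i : measurable_fun setT (shifted_density i).
Proof.
apply: (@measurable_fun_fubini_tonelli_G _ _ _ _ _ P
  (fun z : Omega * R => (exponential_pdf (F i (X0 i)) (z.2 - rho i z.1))%:E)).
  exact: measurable_shift_pair.
by move=> z; rewrite lee_fin pdf_ge0.
Qed.

Lemma shifted_density_ge0 i v : (0 <= shifted_density i v)%E.
Proof. by apply: integral_ge0 => w _; rewrite lee_fin pdf_ge0. Qed.

(** Given [rho i], the sum has the density of the first clock translated by [rho i]; Tonelli
    averages over [rho i]. As [rho i] is real even where the tail diverges, the formula holds for
    every agent, and [rtime_ac] uses it so. *)
Lemma shifted_density_law i B : measurable B ->
  P [set w | B (t i (X0 i) w + rho i w)] =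
  (\int[lebesgue_measure]_(v in B) shifted_density i v)%E.
Proof.
move=> mB; set r := F i (X0 i).
have mtr : measurable_fun setT (fun w => t i (X0 i) w + rho i w).
  by apply: measurable_funD => //; exact: measurable_rhoT.
have mS : measurable [set w | B (t i (X0 i) w + rho i w)].
  by rewrite -[X in measurable X]setTI; exact: mtr.
have m1 : measurable_fun setT (\1_B : R -> R) by exact: measurable_indic.
pose f (z : R * gen_type clock (later i)) := (\1_B (z.1 + rho i z.2))%:E : \bar R.
transitivity (\int[P]_w f (clock (i, X0 i) w, w))%E.
  by rewrite -[X in P X]setIT -integral_indic.
rewrite (@fubini_clock (i, X0 i) (later i) f); first last.
- by move=> z; rewrite lee_fin.
- apply/measurable_EFinP; apply: measurableT_comp => //; apply: measurable_funD => //.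
  exact: (measurable_gen_type_snd (@subset_refl _ _) (@measurable_later i)).
- by move=> [_]; rewrite /= ltnn.
- exact: later_valid.
- by rewrite /valid /=.
pose h (z : Omega * R) := ((\1_B z.2)%:E * (exponential_pdf r (z.2 - rho i z.1))%:E)%E.
have mh : measurable_fun setT h.
  apply: emeasurable_funM; last exact: measurable_shift_pair.
  by apply/measurable_EFinP; apply: measurableT_comp => //; exact: measurable_snd.
have h0 z : (0 <= h z)%E by rewrite mule_ge0// lee_fin// pdf_ge0.
transitivity (\int[P]_w \int[lebesgue_measure]_v h (w, v))%E.
  apply: eq_integral => w _.
  transitivity (\int[lebesgue_measure]_x h (w, x + rho i w)%R)%E.
    by apply: eq_integral => x _; rewrite /f /h /= addrK.
  apply: (@ge0_integral_translate _ (rho i w) (fun v => h (w, v))) => //.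
  exact: measurable_fun_pair2.
transitivity (\int[lebesgue_measure]_v \int[P]_w h (w, v))%E.
  have := @fubini_tonelli _ _ _ (measurableTypeR R) R P (@lebesgue_measure R) h.
  exact.
rewrite [RHS]integral_mkcond; apply: eq_integral => v _.
rewrite /h patchE /= indicE; case: ifPn => vB; rewrite ?vB ?(negbTE vB).
  by apply: eq_integral => w _; rewrite mul1e.
by apply: integral0_eq => w _; rewrite mul0e.
Qed.

(** The explosion time is almost surely the real number [t i (X0 i) + rho i], so both functions are
    densities of one law; this identifies them only up to a null set. *)
Lemma shifted_density_ae i (g : R -> R) : summable_feedback (F i) ->
  is_density P (tail i (X0 i)) g ->
  ae_eq lebesgue_measure setT (EFin \o g) (shifted_density i).
Proof.
move=> Fi [mg [g0 gE]].
have gB B : measurable B -> (\int[lebesgue_measure]_(x in B) (g x)%:E =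
    \int[lebesgue_measure]_(x in B) shifted_density i x)%E.
  move=> mB; rewrite -gE// -shifted_density_law//.
  have mtr : measurable_fun setT (fun w => t i (X0 i) w + rho i w).
    by apply: measurable_funD => //; exact: measurable_rhoT.
  apply: ae_measure_eq.
  - rewrite -[X in measurable X]setTI; apply: measurable_tailT => //.
    exact: measurable_image_EFin.
  - by rewrite -[X in measurable X]setTI; exact: mtr.
  - apply: filterS (ae_tail_fin Fi (leqnSn _)) => w Tw.
    rewrite /preimage /= tail_recl -[tail i _ _]fineK ?ge0_fin_numE ?tail_ge0//.
    rewrite -EFinD -/(rho i w); split => [[y By [<-]]//|Bw].
    by exists (t i (X0 i) w + rho i w).
apply: integral_ae_eq => //.
- apply/integrableP; split; first exact/measurable_EFinP.
  apply: (@le_lt_trans _ _ 1%E); last exact: ltry.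
  have -> : (\int[lebesgue_measure]_x `|(EFin \o g) x| = \int[lebesgue_measure]_x (g x)%:E)%E.
    by apply: eq_integral => x _; rewrite /= ger0_norm.
  rewrite -gE//; apply: probability_le1.
  rewrite -[X in measurable X]setTI; apply: measurable_tailT => //.
  exact: (@measurable_image_EFin R setT measurableT).
- exact: measurable_shifted_density.
- by move=> E _ mE; exact: gB.
Qed.

(** Averaging over [rho i], which is independent of [s] and [Z], gives [shifted_density i (s w)].
    This equals [g (s w)] unless [s w] falls into a Lebesgue null set, which [s] almost surely
    avoids. *)
Lemma rho_identity i (g : R -> R) (s Z : Omega -> R) : summable_feedback (F i) ->
  is_density P (tail i (X0 i)) g ->
  measurable_fun setT (s : gen_type clock (others i) -> R) ->
  (forall N, measurable N -> lebesgue_measure N = 0%E -> P (s @^-1` N) = 0%E) ->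
  measurable_fun setT (Z : gen_type clock (others i) -> R) ->
  (forall w, 0 <= Z w) ->
  (\int[P]_w (exponential_pdf (F i (X0 i)) (s w - rho i w) * Z w)%:E =
   \int[P]_w (g (s w) * Z w)%:E)%E.
Proof.
move=> Fi gi ms sac mZ Z0; have [mg [g0 _]] := gi.
pose f (z : gen_type clock (later i) * gen_type clock (others i)) :=
  (exponential_pdf (F i (X0 i)) (s z.2 - rho i z.1) * Z z.2)%:E.
have mf : measurable_fun setT f.
  apply/measurable_EFinP; apply: measurable_funM.
    apply: measurable_exponential_pdf_comp; apply: measurable_funB.
      by apply: (@measurableT_comp _ _ _ _ _ _ (s : gen_type clock (others i) -> R)).
    apply: (@measurableT_comp _ _ _ _ _ _ (rho i : gen_type clock (later i) -> R)) => //.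
    exact: measurable_later.
  by apply: (@measurableT_comp _ _ _ _ _ _ (Z : gen_type clock (others i) -> R)).
have [msT mZT] := (measurable_clocks ms, measurable_clocks mZ).
transitivity (\int[P]_w f (w, w))%E; first by [].
rewrite (@fubini_clocks (later i) (others i) f) => //.
- transitivity (\int[P]_w (shifted_density i (s w) * (Z w)%:E))%E.
    apply: eq_integral => w _; rewrite /f /shifted_density /= -ge0_integralZr//.
    + by apply/measurable_EFinP; apply: measurable_exponential_pdf_comp;
        apply: measurable_funB; [exact: measurable_cst|exact: measurable_rhoT].
    + by move=> v _; rewrite lee_fin pdf_ge0.
    + by rewrite lee_fin.
  apply: ge0_ae_eq_integral => //.
  + apply: emeasurable_funM; last exact/measurable_EFinP.
    by apply: measurableT_comp => //; exact: measurable_shifted_density.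
  + by apply/measurable_EFinP; apply: measurable_funM => //; exact: measurableT_comp.
  + by move=> w _; rewrite mule_ge0 ?lee_fin// shifted_density_ge0.
  + by move=> w _; rewrite lee_fin mulr_ge0.
  + have [N [mN N0 sub]] := shifted_density_ae Fi gi.
    exists (s @^-1` N); split; first by rewrite -[X in measurable X]setTI; exact: msT.
      exact: sac.
    move=> w /= h; apply: sub => /= h2; apply: h => _.
    by rewrite EFinM -h2.
- exact: later_valid.
- by move=> j [].
- by move=> [j l] [[/= -> _]] [_ /=]; rewrite eqxx.
- by move=> z; rewrite lee_fin mulr_ge0// pdf_ge0.
Qed.

Lemma measurable_rtimeT I : measurable_fun setT (rtime I).
Proof. by apply: (@measurable_clocks _ _ _ setT); exact: measurable_rtime. Qed.

Lemma measurable_rtime_others (I : {set 'I_A}) i : i \in I ->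
  measurable_fun setT (rtime I : gen_type clock (others i) -> R).
Proof.
move=> iI; apply: measurable_rtime => j vj jI; split => //.
by apply: contraNneq jI => ->.
Qed.

(** Being almost surely finite, the minimum is one of finitely many sums [t k (X0 k) + rho k], and
    each of these has a density. *)
Lemma rtime_ac (I : {set 'I_A}) j N : j \notin I -> summable_feedback (F j) ->
  measurable N -> lebesgue_measure N = 0%E -> P (rtime I @^-1` N) = 0%E.
Proof.
move=> jI Fj mN N0.
have mS : measurable (rtime I @^-1` N).
  by rewrite -[X in measurable X]setTI; exact: measurable_rtimeT.
apply/negligibleP => //.
have aeN : {ae P, forall w, forall k, ~ N (t k (X0 k) w + rho k w)}.
  apply: filter_forall => k.
  have mtr : measurable_fun setT (fun w => t k (X0 k) w + rho k w).
    by apply: measurable_funD => //; exact: measurable_rhoT.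
  exists [set w | N (t k (X0 k) w + rho k w)]; split.
  - by rewrite -[X in measurable X]setTI; exact: mtr.
  - rewrite shifted_density_law//.
    transitivity (\int[lebesgue_measure]_(v in N) `|shifted_density k v|)%E.
      by apply: eq_integral => v _; rewrite gee0_abs// shifted_density_ge0.
    apply: integral_abs_eq0 => //; apply: measurable_funTS.
    exact: measurable_shifted_density.
  - by move=> w /= /contrapT.
suff : {ae P, forall w, ~ N (rtime I w)}.
  by apply: negligibleS => w /= h /(_ h).
move: (ae_rest_fin jI Fj) aeN; apply: filterS2 => w Sfin aN Nw.
have [Soo|[k kI Sk]] := rest_cases I w; first by rewrite Soo in Sfin.
apply: (aN k); move: Nw; rewrite /rtime Sk tail_recl fineD// /rho.
by move: Sfin; rewrite Sk tail_recl fin_numD => /andP[].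
Qed.

(** * The window event and its limit *)

Definition window (I : {set 'I_A}) (x : 'I_A -> nat) : set Omega :=
  [set w | forall i, i \in I ->
     psum i (X0 i) (x i) w < rtime I w <= psum i (X0 i) (x i).+1 w].

Lemma measurable_window (I : {set 'I_A}) x : measurable (window I x).
Proof.
have mps i m n : measurable_fun setT (psum i m n).
  by apply: (@measurable_clocks _ _ _ setT); exact: measurable_psum.
have -> : window I x = \bigcap_(i in [set i | i \in I])
    ((fun w => psum i (X0 i) (x i) w < rtime I w <= psum i (X0 i) (x i).+1 w) @^-1` [set true]).
  by apply/seteqP; split => w /=.
apply: fin_bigcap_measurable => [|i _]; first exact: finite_finset.
rewrite -[X in measurable X]setTI.
have mr := measurable_rtimeT I.
have : measurable_fun setT (fun w =>
    psum i (X0 i) (x i) w < rtime I w <= psum i (X0 i) (x i).+1 w).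
  apply: measurable_and; first exact: measurable_fun_ltr.
  exact: measurable_fun_ler.
by move=> /(_ measurableT [set true]); exact.
Qed.

(** The weighted indicator of the window is a product over the agents of [I], and [prod_replace]
    applies [window_identity] to one factor after the other. The strict bound [X0 i < x i] keeps the
    two exchanged clocks distinct. *)
Lemma window_prob (I : {set 'I_A}) x : (forall i, i \in I -> (X0 i < x i)%N) ->
  ((\prod_(i in I) F i (x i))%:E * P (window I x) =
   \int[P]_w (\prod_(i in I)
      exponential_pdf (F i (X0 i)) (rtime I w - psum i (X0 i).+1 (x i).+1 w))%:E)%E.
Proof.
move=> Ix.
have Fx i : i \in I -> 0 < F i (x i) by move=> /Ix /ltnW /F0.
pose a i w := if psum i (X0 i) (x i) w < rtime I w <= psum i (X0 i) (x i).+1 w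
              then F i (x i) else 0.
pose b i w := exponential_pdf (F i (X0 i)) (rtime I w - psum i (X0 i).+1 (x i).+1 w).
pose K i := [set j : 'I_A * nat | valid j /\ (j.1 = i \/ j.1 \notin I)].
have mps i m n : (X0 i <= m)%N -> measurable_fun setT (psum i m n : gen_type clock (K i) -> R).
  move=> im; apply: measurable_psum => l /andP[ml _]; split; last by left.
  exact: leq_trans ml.
have mr i : measurable_fun setT (rtime I : gen_type clock (K i) -> R).
  by apply: measurable_rtime => j vj jI; split => //; right.
have prod_a w : \prod_(i in I) a i w = (\prod_(i in I) F i (x i)) * \1_(window I x) w.
  rewrite indicE; have [wW|/negP wW] := boolP (w \in window I x).
    rewrite mulr1; apply: eq_bigr => i iI; rewrite /a.
    by move/set_mem : wW => /(_ i iI) ->.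
  have /existsNP[i /not_implyP[iI /negP/negbTE wi]] :
      ~ forall i, i \in I -> psum i (X0 i) (x i) w < rtime I w <= psum i (X0 i) (x i).+1 w.
    by move=> h; apply: wW; apply/mem_set.
  by rewrite mulr0 (bigD1 i)//= /a wi mul0r.
have mW := measurable_window I x.
transitivity (\int[P]_w (1 * \prod_(i in I) a i w)%:E)%E.
  under eq_integral do rewrite mul1r prod_a EFinM.
  rewrite ge0_integralZl//.
  - by rewrite integral_indic// setIT.
  - by apply/measurable_EFinP; exact: measurable_indic.
  - by rewrite lee_fin; apply: prodr_ge0 => i /Fx /ltW.
rewrite (@prod_replace I a b (fun=> 1)).
- by apply: eq_integral => w _; rewrite mul1r.
- by move=> i w iI; rewrite /a; case: ifP => // _; exact/ltW/Fx.
- by move=> i w _; exact: pdf_ge0.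
- by [].
- move=> i iI; have mri := mr i; have mpi m := mps i (X0 i) m (leqnn _).
  apply: measurable_fun_ifT; try exact: measurable_cst.
  apply: measurable_and.
    by apply: measurable_fun_ltr; [exact: mpi|exact: mri].
  by apply: measurable_fun_ler; [exact: mri|exact: mpi].
- move=> i iI; apply: measurable_exponential_pdf_comp; apply: measurable_funB.
    exact: mr.
  exact: mps.
- exact: measurable_cst.
- move=> i iI Z mZ Z0; apply: window_identity => //; first exact: Ix.
  exact: measurable_rtime_others.
Qed.

Lemma psum_le_rho i n w : (tail i (X0 i).+1 w < +oo)%E ->
  psum i (X0 i).+1 n w <= rho i w.
Proof.
move=> fin; rewrite -lee_fin /rho fineK ?ge0_fin_numE ?tail_ge0//.
have [Xn|nX] := leqP (X0 i).+1 n; last by rewrite /psum big_geq ?tail_ge0// ltnW.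
by rewrite (tail_split i w Xn) leeDl// tail_ge0.
Qed.

Lemma cvg_psum_rho i (x : nat -> nat) w : (forall n, (n <= x n)%N) ->
  (tail i (X0 i).+1 w < +oo)%E ->
  psum i (X0 i).+1 (x n).+1 w @[n --> \oo] --> rho i w.
Proof.
move=> nx fin.
have Tfin : tail i (X0 i).+1 w \is a fin_num by rewrite ge0_fin_numE ?tail_ge0.
(* Since [n <= x n], the sum lies between the partial sum up to [n] and [rho i]. *)
apply: (@squeeze_cvgr _ _ _ _ (fun n => psum i (X0 i).+1 n w) (fun=> rho i w)).
- apply: nearW => n; rewrite psum_le_rho// andbT.
  have [Xn|nX] := leqP (X0 i).+1 n; last first.
    by rewrite /psum big_geq ?sumr_ge0// ltnW.
  rewrite /psum (@big_cat_nat _ _ _ n _ (x n).+1)//= ?lerDl ?sumr_ge0//.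
  exact: leq_trans (nx n) (leqnSn _).
- have := @cvg_psum_tail i (X0 i).+1 w; rewrite -(fineK Tfin).
  by move=> /fine_cvgP[].
- exact: cvg_cst.
Qed.

(** The density jumps at 0. The partial sums stay below [rho i], so the arguments approach their
    limit from the right, where the density is continuous even at 0. *)
Lemma cvg_exponential_pdf_right r (u : nat -> R) y : 0 <= r -> (forall n, y <= u n) ->
  u n @[n --> \oo] --> y ->
  exponential_pdf r (u n) @[n --> \oo] --> exponential_pdf r y.
Proof.
move=> r0 yu uy; have [y0|y0] := leP 0 y.
  rewrite exponential_pdfE//.
  rewrite [X in X @ _ --> _](_ : _ = fun n => r * expR (- r * u n)); last first.
    by apply/funext => n; rewrite exponential_pdfE// (le_trans y0).
  apply: cvgM; first exact: cvg_cst.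
  apply: continuous_cvg; first exact: continuous_expR.
  by apply: cvgM => //; exact: cvg_cst.
rewrite (lt0_exponential_pdf _ y0).
apply: cvg_near_cst; near=> n; rewrite lt0_exponential_pdf//.
near: n; exact: (uy _ (lt_nbhsl y0)).
Unshelve. all: by end_near. Qed.

Lemma cvg_prod_seq (I : eqType) (s : seq I) (f : I -> nat -> R) (l : I -> R) :
  (forall i, i \in s -> f i n @[n --> \oo] --> l i) ->
  \prod_(i <- s) f i n @[n --> \oo] --> \prod_(i <- s) l i.
Proof.
elim: s => [|i s ih] fl.
  rewrite big_nil; under eq_fun do rewrite big_nil; exact: cvg_cst.
rewrite big_cons; under eq_fun do rewrite big_cons.
apply: cvgM; first by apply: fl; rewrite mem_head.
by apply: ih => j js; apply: fl; rewrite inE js orbT.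
Qed.

Lemma measurable_prod_pdf (I : {set 'I_A}) (h : 'I_A -> Omega -> R) :
  (forall i, measurable_fun setT (h i)) ->
  measurable_fun setT (fun w => (\prod_(i in I) exponential_pdf (F i (X0 i)) (h i w))%:E).
Proof.
move=> mh; apply/measurable_EFinP.
rewrite (_ : (fun w => _) = fun w => \prod_(i <- enum I) exponential_pdf (F i (X0 i)) (h i w)).
  by apply: measurable_prod => i _; exact: measurable_exponential_pdf_comp.
by apply/funext => w; rewrite big_enum.
Qed.

Lemma prod_pdf_le (I : {set 'I_A}) (h : 'I_A -> R) :
  0 <= \prod_(i in I) exponential_pdf (F i (X0 i)) (h i) <= \prod_(i in I) F i (X0 i).
Proof.
rewrite prodr_ge0/=; last by move=> i _; exact: pdf_ge0.
apply: ler_prod => i _; rewrite pdf_ge0/=; apply: exponential_pdf_le.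
exact/ltW/F0.
Qed.

Lemma window_prob_cvg (I : {set 'I_A}) (x : nat -> 'I_A -> nat) :
  (forall i, i \in I -> summable_feedback (F i)) ->
  (forall n i, i \in I -> (n <= x n i)%N) ->
  (\int[P]_w (\prod_(i in I) exponential_pdf (F i (X0 i))
       (rtime I w - psum i (X0 i).+1 (x n i).+1 w))%:E @[n --> \oo] -->
   \int[P]_w (\prod_(i in I) exponential_pdf (F i (X0 i)) (rtime I w - rho i w))%:E)%E.
Proof.
move=> FI nx.
have mps i m n : measurable_fun setT (psum i m n).
  by apply: (@measurable_clocks _ _ _ setT); exact: measurable_psum.
have mr := measurable_rtimeT I.
have [] // := @dominated_convergence _ _ _ P setT measurableT
  (fun n w => (\prod_(i in I) exponential_pdf (F i (X0 i))
       (rtime I w - psum i (X0 i).+1 (x n i).+1 w))%:E)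
  (fun w => (\prod_(i in I) exponential_pdf (F i (X0 i)) (rtime I w - rho i w))%:E)
  (cst (\prod_(i in I) F i (X0 i))%:E).
- by move=> n; apply: measurable_prod_pdf => i; exact: measurable_funB.
- apply: measurable_prod_pdf => i; apply: measurable_funB => //; exact: measurable_rhoT.
- have : {ae P, forall w, forall i, i \in I -> (tail i (X0 i).+1 w < +oo)%E}.
    apply: filter_forall => i; have [iI|iI] := boolP (i \in I); last by apply/aeW.
    by apply: filterS (ae_tail_fin (FI _ iI) (leqnSn _)).
  apply: filterS => w Tw _; apply: cvg_EFin; first exact: nearW.
  rewrite -big_enum; under eq_fun do rewrite -big_enum.
  apply: cvg_prod_seq => i; rewrite mem_enum => iI.
  apply: cvg_exponential_pdf_right; first exact/ltW/F0.
    by move=> n; rewrite lerB// psum_le_rho// Tw.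
  apply: cvgB; first exact: cvg_cst.
  by apply: cvg_psum_rho; [move=> n; exact: nx|exact: Tw].
- exact: finite_measure_integrable_cst.
- apply/aeW => w n _; rewrite /= lee_fin.
  have /andP[h1 h2] := prod_pdf_le I (fun i => rtime I w - psum i (X0 i).+1 (x n i).+1 w).
  by rewrite ger0_norm.
Qed.

(** Again one agent at a time, now with [rho_identity]; the summable agent [j] provides the absolute
    continuity of [rtime I]. *)
Lemma prod_pdf_density (I : {set 'I_A}) j (g : 'I_A -> R -> R) :
  j \notin I -> summable_feedback (F j) ->
  (forall i, i \in I -> summable_feedback (F i)) ->
  (forall i, i \in I -> is_density P (tail i (X0 i)) (g i)) ->
  (\int[P]_w (\prod_(i in I) exponential_pdf (F i (X0 i)) (rtime I w - rho i w))%:E =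
   \int[P]_w (\prod_(i in I) g i (rtime I w))%:E)%E.
Proof.
move=> jI Fj FI gI.
have E (h : 'I_A -> Omega -> R) : (\int[P]_w (\prod_(i in I) h i w)%:E =
    \int[P]_w (1 * \prod_(i in I) h i w)%:E)%E.
  by apply: eq_integral => w _; rewrite mul1r.
pose K i := [set j : 'I_A * nat | valid j /\ (j.1 = i \/ j.1 \notin I)].
have mr i : measurable_fun setT (rtime I : gen_type clock (K i) -> R).
  by apply: measurable_rtime => k vk kI; split => //; right.
have mrho i : measurable_fun setT (rho i : gen_type clock (K i) -> R).
  apply: (@measurable_gen_type_sub _ _ _ _ clock (later i)); last exact: measurable_later.
  by move=> k kl; split; [exact: later_valid kl|left; case: kl].
rewrite (E (fun i w => exponential_pdf (F i (X0 i)) (rtime I w - rho i w))).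
rewrite (E (fun i w => g i (rtime I w))).
apply: prod_replace => //.
- by move=> i w _; exact: pdf_ge0.
- by move=> i w /gI[_ [g0 _]].
- move=> i iI; apply: measurable_exponential_pdf_comp; apply: measurable_funB.
    exact: mr.
  exact: mrho.
- by move=> i /gI[mg _]; apply: measurableT_comp => //; exact: mr.
- move=> i iI Z mZ Z0; apply: rho_identity => //; [exact: FI|exact: gI| |].
    exact: measurable_rtime_others.
  by move=> N; exact: (rtime_ac jI Fj).
Qed.

(** [rtime I] is almost surely at least some positive first clock. Hence the events with
    [e = 1 / (n + 1)] cover the space up to a null set and cannot all be null. *)
Lemma rtime_ge_gt0 (I : {set 'I_A}) j : j \notin I -> summable_feedback (F j) ->
  exists2 e : R, 0 < e & (0 < P [set w | (e <= rtime I w)%R])%E.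
Proof.
move=> jI Fj; apply: contrapT => /forall2NP h.
have mr := measurable_rtimeT I.
have mS e : measurable [set w | e <= rtime I w].
  have : measurable_fun setT (fun w => e <= rtime I w).
    by apply: measurable_fun_ler => //; exact: measurable_cst.
  by move=> /(_ measurableT [set true]); rewrite setTI; exact.
have : {ae P, forall w, forall n, ~ (n.+1%:R^-1 <= rtime I w)}.
  apply: ae_foralln => n; exists [set w | n.+1%:R^-1 <= rtime I w]; split => //.
    apply/eqP; rewrite -measure_le0 leNgt; apply/negP.
    by have [] := h n.+1%:R^-1; rewrite ?invr_gt0 ?ltr0n.
  by move=> w /= /contrapT.
have rpos : {ae P, forall w, 0 < rtime I w}.
  move: (ae_rest_fin jI Fj) ae_clock_gt0; apply: filterS2 => w Sfin tw.
  have [Soo|[k kI Sk]] := rest_cases I w; first by rewrite Soo in Sfin.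
  apply: fine_gt0; rewrite -ge0_fin_numE ?rest_ge0// Sfin andbT Sk tail_recl.
  apply: (@lt_le_trans _ _ (t k (X0 k) w)%:E); last by rewrite leeDl ?tail_ge0.
  by rewrite lte_fin; exact: tw.
move=> nr; suff : {ae P, forall w : Omega, False}.
  move=> [N [_ N0 sub]]; have NT : N = setT.
    by apply/seteqP; split => // w _; apply: sub => /=.
  by have := probability_setT P; rewrite -NT [X in X = _ -> _]N0 => /eqP; rewrite eq_sym onee_eq0.
move: nr rpos; apply: filterS2 => w nr r0.
apply: (nr (Num.truncn (rtime I w)^-1)).
rewrite -[leRHS]invrK lef_pV2 ?posrE ?invr_gt0//.
exact/ltW/truncnS_gt.
Qed.

(** Where [rtime I >= e] and every [rho i <= e], all arguments are nonnegative and all factors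
    positive. This event has positive probability because its conditions concern disjoint sets of
    clocks. *)
Lemma prod_pdf_gt0 (I : {set 'I_A}) j :
  j \notin I -> summable_feedback (F j) ->
  (forall i, i \in I -> summable_feedback (F i)) ->
  (0 < \int[P]_w (\prod_(i in I) exponential_pdf (F i (X0 i)) (rtime I w - rho i w))%:E)%E.
Proof.
move=> jI Fj FI; have [e e0 eP] := rtime_ge_gt0 jI Fj.
pose a i w : R := if rho i w <= e then 1 else 0.
pose c i : R := fine (P [set w | (rho i w <= e)%R]).
pose Y w : R := if e <= rtime I w then 1 else 0.
pose D w : R := \prod_(i in I) exponential_pdf (F i (X0 i)) (rtime I w - rho i w).
have mS (K : set ('I_A * nat)) (h : Omega -> R) (b : R) :
    measurable_fun setT (h : gen_type clock K -> R) ->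
    measurable_fun setT ((fun w => if h w <= b then 1 else 0) : gen_type clock K -> R).
  move=> mh; apply: measurable_fun_ifT; try exact: measurable_cst.
  by apply: measurable_fun_ler => //; exact: measurable_cst.
have mrho i : measurable [set w | rho i w <= e].
  have : measurable_fun setT (fun w => rho i w <= e).
    by apply: measurable_fun_ler; [exact: measurable_rhoT|exact: measurable_cst].
  by move=> /(_ measurableT [set true]); rewrite setTI; exact.
have ma i (K : set ('I_A * nat)) : later i `<=` K ->
    measurable_fun setT (a i : gen_type clock K -> R).
  move=> iK; apply: (mS K (rho i)).
  by apply: (@measurable_gen_type_sub _ _ _ _ clock (later i)); last exact: measurable_later.
have mY K : (forall j, valid j -> j.1 \notin I -> K j) ->
    measurable_fun setT (Y : gen_type clock K -> R).
  move=> IK; apply: measurable_fun_ifT; try exact: measurable_cst.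
  by apply: measurable_fun_ler; [exact: measurable_cst|exact: measurable_rtime].
have Y0 w : 0 <= Y w by rewrite /Y; case: ifP.
have a0 i w : 0 <= a i w by rewrite /a; case: ifP.
have c0 i : 0 <= c i by rewrite fine_ge0.
have mYT : measurable_fun setT Y by apply: (@measurable_clocks _ _ _ setT); exact: mY.
have intY : (\int[P]_w (Y w)%:E = P [set w | (e <= rtime I w)%R])%E.
  have mr := measurable_rtimeT I.
  have mE : measurable [set w | e <= rtime I w].
    have : measurable_fun setT (fun w => e <= rtime I w).
      by apply: measurable_fun_ler => //; exact: measurable_cst.
    by move=> /(_ measurableT [set true]); rewrite setTI; exact.
  rewrite -[X in _ = P X]setIT -integral_indic//; apply: eq_integral => w _.
  by rewrite indicE /Y; case: ifPn => h; [rewrite mem_set|rewrite memNset//; exact/negP].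
have aYgt0 : (0 < \int[P]_w (Y w * \prod_(i in I) a i w)%:E)%E.
  (* Replacing each indicator by its probability [c i] factorizes the probability of the event. *)
  rewrite (@prod_replace I a (fun i _ => c i) Y) => //.
  - have C0 : 0 < \prod_(i in I) c i.
      apply: prodr_gt0 => i iI; rewrite /c fine_gt0//.
      rewrite -ge0_fin_numE// fin_num_measure// andbT.
      apply: lt_le_trans (tail_small_gt0 (FI _ iI) (leqnSn _) e0) _.
      apply: le_measure; rewrite ?inE//.
        by apply: (@gen_measurable setT); exact: measurable_tail_le.
      move=> w /= Tw; rewrite -lee_fin /rho fineK// ge0_fin_numE ?tail_ge0//.
      exact: le_lt_trans Tw (ltry _).
    under eq_integral do rewrite EFinM.
    rewrite ge0_integralZr ?lee_fin// ?(ltW C0)//; last 2 first.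
    + exact/measurable_EFinP.
    + by move=> w _; rewrite lee_fin.
    by rewrite intY mule_gt0.
  - by move=> i iI; apply: ma => k kl; split; [exact: later_valid kl|left; case: kl].
  - by apply: mY => k vk kI; split.
  - move=> i iI Z mZ Z0.
    pose f (z : gen_type clock (later i) * gen_type clock (others i)) :=
      (a i z.1 * Z z.2)%:E.
    transitivity (\int[P]_w f (w, w))%E; first by [].
    rewrite (@fubini_clocks (later i) (others i) f).
    + apply: eq_integral => w _; rewrite /f /=.
      under eq_integral do rewrite EFinM.
      rewrite ge0_integralZr ?lee_fin//; last 2 first.
      * by apply/measurable_EFinP; apply: (@measurable_clocks _ _ _ (later i)); exact: ma.
      * by move=> v _; rewrite lee_fin.
      rewrite EFinM; congr (_ * _)%E.
      rewrite /c fineK ?fin_num_measure// -[X in _ = P X]setIT -integral_indic//.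
      apply: eq_integral => v _.
      by rewrite indicE /a; case: ifPn => h; [rewrite mem_set|rewrite memNset//; exact/negP].
    + exact: later_valid.
    + by move=> k [].
    + by move=> [k l] [[/= -> _]] [_ /=]; rewrite eqxx.
    + apply/measurable_EFinP; apply: measurable_funM.
        apply: (@measurableT_comp _ _ _ _ _ _ (a i : gen_type clock (later i) -> R)) => //.
        exact: ma.
      by apply: (@measurableT_comp _ _ _ _ _ _ (Z : gen_type clock (others i) -> R)).
    + by move=> z; rewrite lee_fin mulr_ge0.
have D0 w : 0 <= D w by have /andP[] := prod_pdf_le I (fun i => rtime I w - rho i w).
have mD : measurable_fun setT (fun w => (D w)%:E).
  apply: measurable_prod_pdf => i; apply: measurable_funB; first exact: measurable_rtimeT.
  exact: measurable_rhoT.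
rewrite lt0e integral_ge0 ?andbT; last by move=> w _; rewrite lee_fin; exact: D0.
apply/eqP => int0; move: aYgt0.
suff -> : (\int[P]_w (Y w * \prod_(i in I) a i w)%:E = 0)%E by rewrite ltxx.
have aeD : ae_eq P setT (fun w => (D w)%:E) (cst 0%E).
  apply/(ae_eq_integral_abs P measurableT mD); rewrite -[RHS]int0.
  by apply: eq_integral => w _; rewrite gee0_abs// lee_fin.
rewrite -[RHS](@integral0 _ _ _ P setT).
apply: ge0_ae_eq_integral => //.
- apply/measurable_EFinP; apply: measurable_funM => //.
  rewrite (_ : (fun w => _) = fun w => \prod_(i <- enum I) a i w).
    by apply: measurable_prod => i _; apply: (@measurable_clocks _ _ _ (later i)); exact: ma.
  by apply/funext => w; rewrite big_enum.
- by move=> w _; rewrite lee_fin mulr_ge0// prodr_ge0.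
- apply: filterS aeD => w /(_ Logic.I) /= [Dw] _; congr EFin; apply/eqP; apply: contraT => Ya.
  move: Ya; rewrite mulf_eq0 negb_or => /andP[Yw /prodf_neq0 aw].
  have er : e <= rtime I w by move: Yw; rewrite /Y; case: ifP => //; rewrite eqxx.
  suff : 0 < D w by rewrite Dw ltxx.
  apply: prodr_gt0 => i iI; have rhoe : rho i w <= e.
    by move: (aw i iI); rewrite /a; case: ifP => //; rewrite eqxx.
  rewrite exponential_pdfE ?subr_ge0 ?(le_trans rhoe)//.
  by rewrite mulr_gt0 ?expR_gt0// F0.
Qed.

Lemma window_limit (I : {set 'I_A}) j (g : 'I_A -> R -> R) (x : nat -> 'I_A -> nat)
    (L := fine (\int[P]_w (\prod_(i in I) g i (rtime I w))%:E)%E) :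
  j \notin I -> summable_feedback (F j) ->
  (forall i, i \in I -> summable_feedback (F i)) ->
  (forall i, i \in I -> is_density P (tail i (X0 i)) (g i)) ->
  (forall n i, i \in I -> (n <= x n i)%N) ->
  0 < L /\
  (\prod_(i in I) F i (x n i)) * fine (P (window I (x n))) @[n --> \oo] --> L.
Proof.
move=> jI Fj FI gI nx.
have VE := prod_pdf_density jI Fj FI gI.
have V0 := prod_pdf_gt0 jI Fj FI.
have Vfin : (\int[P]_w (\prod_(i in I) exponential_pdf (F i (X0 i)) (rtime I w - rho i w))%:E
    < +oo)%E.
  apply: (@le_lt_trans _ _ (\int[P]_w (cst (\prod_(i in I) F i (X0 i))%:E w))%E).
    apply: ge0_le_integral => //.
    - by move=> w _; rewrite lee_fin; have /andP[] := prod_pdf_le I (fun i => rtime I w - rho i w).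
    - apply: measurable_prod_pdf => i; apply: measurable_funB; first exact: measurable_rtimeT.
      exact: measurable_rhoT.
    - by move=> w _; rewrite lee_fin; have /andP[] := prod_pdf_le I (fun i => rtime I w - rho i w).
  rewrite (integral_cst P measurableT) [X in (_ * X)%E](_ : _ = 1%E) ?mule1 ?ltry//.
  exact: probability_setT.
have LE : (\int[P]_w (\prod_(i in I) exponential_pdf (F i (X0 i)) (rtime I w - rho i w))%:E
    = L%:E)%E.
  by rewrite /L -VE fineK// ge0_fin_numE// ltW.
split; first by rewrite -lte_fin -LE.
have := window_prob_cvg FI nx; rewrite LE => /fine_cvgP[_].
apply: cvg_trans; apply: near_eq_cvg; near=> n.
rewrite /= -window_prob ?fineM ?fin_num_measure//; first exact: measurable_window.
move=> i iI; apply: leq_trans (nx n i iI).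
apply: leq_trans (_ : \max_i X0 i < n)%N; first by rewrite ltnS leq_bigmax.
near: n; exact: nbhs_infty_gt.
Unshelve. all: by end_near. Qed.

End Sojourn.

(** * The urn and the birth processes *)

Section Urn.
Context {R : realType} {d : measure_display} {Omega : measurableType d}.
Variables (A : nat) (X0 : 'I_A -> nat) (tau : 'I_A -> nat -> Omega -> R).
Local Notation Xi := (Xi X0 tau).
Local Notation jump_time := (jump_time X0 tau).
Local Notation sigma i k w := (\sum_(X0 i <= l < k) tau i l w).

Lemma Xi_someP i (r : \bar R) w k :
  Xi i r w = Some k <->
  ((r < (sigma i k.+1 w)%:E)%E /\
   forall m, (m < k)%N -> ((sigma i m.+1 w)%:E <= r)%E).
Proof.
rewrite /Defs.Xi; case: pselect => [H|H]; last first.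
  split=> // -[h _]; exfalso; apply: H; exists k; exact: h.
case: ex_minnP => m Hm mmin; split => [[<-]|[h1 h2]].
  split=> // q qm; rewrite leNgt; apply/negP => h.
  by have := mmin q h; rewrite leqNgt qm.
congr Some; apply/eqP; rewrite eqn_leq mmin//= leqNgt; apply/negP => mk.
by have := h2 m mk; rewrite leNgt => /negP; apply.
Qed.

Lemma Xi_noneP i (r : \bar R) w :
  Xi i r w = None <-> forall m, ((sigma i m.+1 w)%:E <= r)%E.
Proof.
rewrite /Defs.Xi; case: pselect => [H|H]; split => //.
- by case: (H) => k hk /(_ k); rewrite leNgt => /negP [].
- by move=> _ m; rewrite leNgt; apply/negP => h; apply: H; exists m.
Qed.

(** [Xi] is nondecreasing in time, [None] being its largest value, so equal values at both ends
    force the value in between. *)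
Lemma Xi_stable i (r s u : \bar R) w : (r <= s)%E -> (s <= u)%E ->
  Xi i u w = Xi i r w -> Xi i s w = Xi i r w.
Proof.
move=> rs su; case E : (Xi i r w) => [k|].
  move=> /Xi_someP[h _]; move/Xi_someP : E => [_ h2]; apply/Xi_someP.
  by split; [exact: le_lt_trans su h|move=> m /h2 h3; exact: le_trans h3 rs].
by move=> _; apply/Xi_noneP => m; move/Xi_noneP : E => /(_ m) h; exact: le_trans h rs.
Qed.

(** * A single sample path up to the first explosion *)

Section Path.
Variable w : Omega.
Hypothesis tau_gt0 : forall i l, (X0 i <= l)%N -> 0 < tau i l w.
Variable Tm : \bar R.
Hypothesis Tm_le : forall i, (Tm <= explosion_time X0 tau i w)%E.
Variable i0 : 'I_A.
Hypothesis Tm_i0 : explosion_time X0 tau i0 w = Tm.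

Let sigma_mono i k m : (k <= m)%N -> sigma i k w <= sigma i m w.
Proof.
move=> km; have [ik|ki] := leqP (X0 i) k; last first.
  rewrite [leLHS]big_geq; last exact: ltnW.
  by rewrite big_nat; apply: sumr_ge0 => l /andP[il _]; exact/ltW/tau_gt0.
rewrite (big_cat_nat ik km)/= lerDl.
by rewrite big_nat; apply: sumr_ge0 => l /andP[kl _]; apply/ltW/tau_gt0/(leq_trans ik).
Qed.

Let sigma_lt i k : (X0 i <= k)%N -> sigma i k w < sigma i k.+1 w.
Proof. by move=> ik; rewrite big_nat_recr//= ltrDl tau_gt0. Qed.

Let sigma_le_explosion i k : ((sigma i k w)%:E <= explosion_time X0 tau i w)%E.
Proof.
rewrite -sumEFin /explosion_time; apply: nneseries_lim_ge => l il _.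
by rewrite lee_fin; exact/ltW/tau_gt0.
Qed.

Lemma sigma_lt_explosion i k : ((sigma i k w)%:E < explosion_time X0 tau i w)%E.
Proof.
(* Below [X0 i] the sums are empty and do not grow; [k] is first raised to [X0 i], from where each
   further clock is positive. *)
apply: le_lt_trans (_ : (sigma i (maxn k (X0 i)) w)%:E < _)%E.
  by rewrite lee_fin sigma_mono// leq_maxl.
apply: lt_le_trans (sigma_le_explosion i (maxn k (X0 i)).+1).
by rewrite lte_fin sigma_lt// leq_maxr.
Qed.

Let explosion_sup i (r : R) : (r%:E < explosion_time X0 tau i w)%E ->
  exists k, r < sigma i k w.
Proof.
move=> rT; apply: contrapT => /forallNP h; move: rT; rewrite ltNge => /negP; apply.
apply: lime_le.
  apply: is_cvg_nneseries => l il _; rewrite lee_fin; exact/ltW/tau_gt0.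
by apply: nearW => k; rewrite sumEFin lee_fin leNgt; apply/negP.
Qed.

Let Xi_intro i (r : R) k : (X0 i <= k)%N -> sigma i k w <= r -> r < sigma i k.+1 w ->
  Xi i r%:E w = Some k.
Proof.
move=> ik h1 h2; apply/Xi_someP; split=> [|m mk]; first by rewrite lte_fin.
by rewrite lee_fin; apply: le_trans h1; exact: sigma_mono.
Qed.

Let Xi_elim i (r : R) k : 0 <= r -> Xi i r%:E w = Some k ->
  [/\ (X0 i <= k)%N, sigma i k w <= r & r < sigma i k.+1 w].
Proof.
move=> r0 /Xi_someP[]; rewrite lte_fin => h1 h2.
have ik : (X0 i <= k)%N.
  rewrite leqNgt; apply/negP => ki; move: h1; rewrite big_geq// ltNge.
  by rewrite r0.
split=> //; case: k ik h1 h2 => [|k] ik h1 h2; first by rewrite big_geq.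
by have := h2 k (ltnSn _); rewrite lee_fin.
Qed.

Let Xi_exists i (r : R) : 0 <= r -> (r%:E < explosion_time X0 tau i w)%E ->
  exists k, Xi i r%:E w = Some k.
Proof.
move=> r0 /explosion_sup[k rk]; case E : (Xi i r%:E w) => [m|]; first by exists m.
have ik : (0 < k)%N.
  by case: k rk => //; rewrite big_geq// ltNge r0.
move/Xi_noneP : E => /(_ k.-1); rewrite prednK// lee_fin leNgt => /negP; tauto.
Qed.

(** Before [Tm] every process is finite, and the next jump of the urn is the least of the next jumps
    [m j]. It precedes [Tm], because [m i0] is a partial sum of the explosion time [Tm] of [i0]. *)
Lemma jump_step n (r : R) : 0 <= r -> jump_time n w = r%:E -> (r%:E < Tm)%E ->
  exists s : R, [/\ r < s, jump_time n.+1 w = s%:E, (s%:E < Tm)%E &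
    exists j k, Xi j r%:E w = Some k /\ sigma j k.+1 w = s].
Proof.
move=> r0 nr rT.
have [k Hk] : exists k : 'I_A -> nat, forall j, Xi j r%:E w = Some (k j).
  have H j : exists k, Xi j r%:E w = Some k.
    by apply: Xi_exists => //; exact: lt_le_trans rT (Tm_le j).
  by exists (fun j => sval (cid (H j))) => j; case: cid.
have kP j := Xi_elim r0 (Hk j).
pose m j := sigma j (k j).+1 w.
pose js := [arg min_(j < i0) m j]%O.
have jsP j : m js <= m j.
  by rewrite /js; case: Order.TotalTheory.arg_minP => // i _ /(_ j isT).
have rm : r < m js by have [] := kP js.
exists (m js); split => //.
(* The infimum is attained at [m js], where [Xi js] moves to [k js + 1]; until then no process has
   moved. *)
- rewrite /= nr; apply/eqP; rewrite eq_le; apply/andP; split.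
    apply: ereal_inf_lbound; exists (m js); split => //; split; first by rewrite lte_fin.
    exists js; rewrite Hk (@Xi_intro js (m js) (k js).+1)//.
    + by move=> [] /eqP; rewrite -[X in _ == X]addn0 -addn1 eqn_add2l.
    + by have [h _ _] := kP js; exact: leqW.
    + by apply: sigma_lt; have [h _ _] := kP js; exact: leqW.
  apply: le_ereal_inf_tmp => _ [s [-> [rs [j]]]]; rewrite leNgt; move: rs.
  rewrite lte_fin => rs neq; apply/negP; rewrite lte_fin => sm; apply: neq.
  have [h1 h2 h3] := kP j.
  rewrite Hk; apply: Xi_intro => //; first exact: le_trans h2 (ltW rs).
  exact: lt_le_trans sm (jsP j).
- apply: le_lt_trans (_ : (m i0)%:E < _)%E; first by rewrite lee_fin.
  by rewrite -Tm_i0; exact: sigma_lt_explosion.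
- by exists js, (k js).
Qed.

Lemma Tm_gt0 : (0 < Tm)%E.
Proof.
rewrite -Tm_i0; have := sigma_lt_explosion i0 0.
by rewrite big_geq.
Qed.

Lemma jump_time_real n : exists r : R, [/\ 0 <= r, jump_time n w = r%:E & (r%:E < Tm)%E].
Proof.
elim: n => [|n [r [r0 nr rT]]]; first by exists 0; split => //; exact: Tm_gt0.
have [s [rs ns sT _]] := jump_step r0 nr rT.
by exists s; split => //; exact: le_trans r0 (ltW rs).
Qed.

Lemma jump_time_nd n m : (n <= m)%N -> (jump_time n w <= jump_time m w)%E.
Proof.
move=> nm; rewrite -(subnK nm); elim: (m - n)%N => // q ih.
apply: le_trans ih _; have [r [r0 nr rT]] := jump_time_real (q + n).
by have [s [rs ns _ _]] := jump_step r0 nr rT; rewrite addSn ns nr lee_fin ltW.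
Qed.

(* Each jump increases one coordinate, so if the jump times stayed below
   [u < Tm] the coordinates would stay bounded, which is absurd. *)
Lemma jump_time_cofinal (u : R) : (u%:E < Tm)%E -> exists n, (u%:E <= jump_time n w)%E.
Proof.
move=> uT; apply: contrapT => /forallNP h.
have hlt n : (jump_time n w < u%:E)%E by rewrite ltNge; apply/negP.
have [K HK] : exists K : 'I_A -> nat, forall j, u < sigma j (K j) w.
  have H j : exists k, u < sigma j k w.
    by apply: explosion_sup; exact: lt_le_trans uT (Tm_le j).
  by exists (fun j => sval (cid (H j))) => j; case: cid.
pose c n j := odflt 0%N (Xi j (jump_time n w) w).
have cP n r : 0 <= r -> jump_time n w = r%:E -> (r%:E < Tm)%E ->
    forall j, Xi j r%:E w = Some (c n j).
  move=> r0 nr rT j; have [|k hk] := @Xi_exists j r r0; last by rewrite /c nr hk.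
  exact: lt_le_trans rT (Tm_le j).
have cK n j : (c n j <= K j)%N.
  have [r [r0 nr rT]] := jump_time_real n.
  have [_ h1 _] := Xi_elim r0 (cP _ _ r0 nr rT j).
  rewrite leqNgt; apply/negP => /ltnW /sigma_mono h2.
  have := le_lt_trans h1 (_ : r < u); have := hlt n; rewrite nr lte_fin => ru /(_ ru).
  by move=> /lt_trans /(_ (HK j)); rewrite ltNge h2.
have cS n : (\sum_j c n j < \sum_j c n.+1 j)%N.
  have [r [r0 nr rT]] := jump_time_real n.
  have [s [rs ns sT [j [k [jk ks]]]]] := jump_step r0 nr rT.
  have s0 : 0 <= s by exact: le_trans r0 (ltW rs).
  have mono i : (c n i <= c n.+1 i)%N.
    have [_ h1 _] := Xi_elim r0 (cP _ _ r0 nr rT i).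
    have [_ _ h2] := Xi_elim s0 (cP _ _ s0 ns sT i).
    rewrite -ltnS ltnNge; apply/negP => /(@sigma_mono i) h3.
    by have := lt_le_trans (lt_trans (le_lt_trans h1 rs) h2) h3; rewrite ltxx.
  rewrite (bigD1 j)//= [in X in (_ < X)%N](bigD1 j)//= -addSn leq_add//; last first.
    by apply: leq_sum => i _; exact: mono.
  have [_ _ h2] := Xi_elim s0 (cP _ _ s0 ns sT j).
  have kE : c n j = k by have := cP _ _ r0 nr rT j; rewrite jk => -[].
  rewrite ltnNge; apply/negP => cc; move: h2; rewrite -ks ltNge sigma_mono//.
  by rewrite ltnS -kE.
have cn n : (n <= \sum_j c n j)%N.
  by elim: n => // n ih; exact: leq_ltn_trans ih (cS n).
have := cn (\sum_j K j).+1; rewrite ltnNge => /negP; apply.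
exact: leq_sum.
Qed.

(** The jump times are cofinal below [Tm] but never reach it: hence the strict inequality on the
    left and the weak one on the right. *)
Lemma urn_limitP i x : (X0 i <= x)%N ->
  urn_limit_is X0 tau i x w <->
  ((sigma i x w)%:E < Tm)%E /\ (Tm <= (sigma i x.+1 w)%:E)%E.
Proof.
move=> ix; split => [[N HN]|[h1 h2]].
  have H n : (N <= n)%N -> exists r : R, [/\ jump_time n w = r%:E, (r%:E < Tm)%E,
      sigma i x w <= r & r < sigma i x.+1 w].
    move=> Nn; have [r [r0 nr rT]] := jump_time_real n; exists r; split => //.
    - by have := HN n Nn; rewrite /urn nr => /(Xi_elim r0)[].
    - by have := HN n Nn; rewrite /urn nr => /(Xi_elim r0)[].
  split.
    have [r [_ rT h _]] := H N (leqnn _); apply: le_lt_trans rT.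
    by rewrite lee_fin.
  rewrite leNgt; apply/negP => /jump_time_cofinal[n hn].
  have [r [nr _ _]] := H (maxn n N) (leq_maxr _ _).
  have := le_trans hn (jump_time_nd (leq_maxl n N)).
  by rewrite nr lee_fin => h; rewrite ltNge h.
have [N HN] := jump_time_cofinal h1; exists N => n Nn.
have [r [r0 nr rT]] := jump_time_real n; rewrite /urn nr; apply: Xi_intro => //.
- by rewrite -lee_fin -nr; exact: le_trans HN (jump_time_nd Nn).
- by rewrite -lte_fin; exact: lt_le_trans rT h2.
Qed.

End Path.

(** * Measurability of the urn events *)

Section UrnMeasurability.
Hypothesis mtau : forall i k, measurable_fun [set: Omega] (tau i k).

Let msigma i k : measurable_fun setT (fun w => (sigma i k w)%:E).
Proof. by apply/measurable_EFinP; apply: measurable_sum => l; exact: mtau. Qed.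

Lemma measurable_Xi_some i (u : Omega -> \bar R) k : measurable_fun setT u ->
  measurable [set w | Xi i (u w) w = Some k].
Proof.
move=> mu.
have mle m : measurable [set w | ((sigma i m.+1 w)%:E <= u w)%E].
  by rewrite -[X in measurable X]setTI; exact: emeasurable_fun_le.
have -> : [set w | Xi i (u w) w = Some k] =
    [set w | (u w < (sigma i k.+1 w)%:E)%E] `&`
    \bigcap_(m in `I_k) [set w | ((sigma i m.+1 w)%:E <= u w)%E].
  by apply/seteqP; split => w /=; rewrite Xi_someP.
apply: measurableI; last exact: bigcap_measurableType.
by rewrite -[X in measurable X]setTI; exact: emeasurable_fun_lt.
Qed.

Lemma measurable_Xi_eq i (u v : Omega -> \bar R) : measurable_fun setT u ->
  measurable_fun setT v -> measurable [set w | Xi i (u w) w = Xi i (v w) w].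
Proof.
move=> mu mv.
have mN f : measurable_fun setT f -> measurable [set w | Xi i (f w) w = None].
  move=> mf; have -> : [set w | Xi i (f w) w = None] =
      ~` \bigcup_k [set w | Xi i (f w) w = Some k].
    apply/seteqP; split => w /=; first by move=> fN [k _ /=]; rewrite fN.
    by case E : (Xi i (f w) w) => [k|//] h; exfalso; apply: h; exists k.
  apply: measurableC; apply: bigcupT_measurable => k; exact: measurable_Xi_some.
have -> : [set w | Xi i (u w) w = Xi i (v w) w] =
    ([set w | Xi i (u w) w = None] `&` [set w | Xi i (v w) w = None]) `|`
    \bigcup_k ([set w | Xi i (u w) w = Some k] `&` [set w | Xi i (v w) w = Some k]).
  apply/seteqP; split => w /=.
    case E : (Xi i (u w) w) => [k|] /esym E2; first by right; exists k.
    by left.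
  by move=> [[-> ->//]|[k _ [/= -> ->]]].
apply: measurableU; first by apply: measurableI; exact: mN.
by apply: bigcupT_measurable => k; apply: measurableI; exact: measurable_Xi_some.
Qed.

(* As [Xi] is monotone in time, a jump before [y] is seen at a rational time. *)
Lemma measurable_jump_time n : measurable_fun setT (jump_time n).
Proof.
elim: n => [|n ih]; first exact: measurable_cst.
move=> _; apply: (measurability _ (ErealGenInftyO.measurableE R)) => //.
move=> _ [_ [y ->] <-]; rewrite setTI.
pose B (q : R) := [set w | (jump_time n w < q%:E)%E] `&`
   \bigcup_(j in [set: 'I_A]) ~` [set w | Xi j q%:E w = Xi j (jump_time n w) w].
have mB q : measurable (B q).
  apply: measurableI.
    by rewrite -[X in measurable X]setTI; apply: emeasurable_fun_infty_o.
  apply: fin_bigcup_measurable => [|j _]; first exact: finite_finset.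
  by apply: measurableC; apply: measurable_Xi_eq => //; exact: measurable_cst.
have -> : jump_time n.+1 @^-1` `]-oo, y%:E[ =
    \bigcup_(q : rat) (if ratr q < y then B (ratr q) else set0).
  apply/seteqP; split => w /=; last first.
    move=> [q _ /=]; case: ifPn => // qy [nq [j _ /= jq]]; rewrite in_itv/=.
    apply: le_lt_trans (_ : ((ratr q)%:E < y%:E)%E); last by rewrite lte_fin.
    by apply: ereal_inf_lbound; exists (ratr q); split => //; split => //; exists j.
  rewrite in_itv/= => /ereal_inf_lt[_ [s [-> [ns [j js]]]]].
  rewrite lte_fin => /rat_in_itvoo[q]; rewrite in_itv/= => /andP[sq qy].
  exists q => //; rewrite qy; split; first by rewrite /= (lt_trans ns)// lte_fin.
  exists j => //= h; apply: js; apply: Xi_stable h; first exact: ltW.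
  by rewrite lee_fin ltW.
by apply: bigcupT_measurable_rat => q; case: ifP.
Qed.

Lemma measurable_urn_limit i x : measurable (urn_limit_is X0 tau i x).
Proof.
have -> : urn_limit_is X0 tau i x =
    \bigcup_N \bigcap_(n in [set n | (N <= n)%N]) [set w | Xi i (jump_time n w) w = Some x].
  apply/seteqP; split => w /=; first by move=> [N HN]; exists N => // n; exact: HN.
  by move=> [N _ HN]; exists N => n Nn; exact: HN.
apply: bigcupT_measurable => N; apply: bigcap_measurableType => n _.
by apply: measurable_Xi_some; exact: measurable_jump_time.
Qed.

(** The clocks have no sign here, so the partial sums may diverge, and the limit then takes the
    default value [point]; comparing upper and lower limits decides the case. *)
Lemma measurable_explosion_time i : measurable_fun setT (explosion_time X0 tau i).
Proof.
pose u (w : Omega) n : \bar R := (\sum_(X0 i <= k < n) (tau i k w)%:E)%E.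
have mu n : measurable_fun setT (fun w => u w n).
  by apply: emeasurable_sum => k; apply/measurable_EFinP; exact: mtau.
have msup : measurable_fun setT (fun w => limn_esup (u w)).
  exact: (@measurable_fun_limn_esup _ _ _ setT (fun n w => u w n)).
have minf : measurable_fun setT (fun w => limn_einf (u w)).
  rewrite (_ : (fun w => _) = fun w => - limn_esup (-%E \o u w))%E; last first.
    by apply/funext => w; rewrite limn_esupN oppeK.
  apply: measurableT_comp => //.
  apply: (@measurable_fun_limn_esup _ _ _ setT (fun n w => - u w n))%E => n.
  exact: measurableT_comp.
rewrite (_ : explosion_time X0 tau i = fun w =>
    if (limn_esup (u w) <= limn_einf (u w))%E then limn_esup (u w) else point).
  apply: measurable_fun_ifT => //.
  apply: (measurable_fun_bool true); rewrite setTI.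
  by rewrite -[X in measurable X]setTI; exact: emeasurable_fun_le.
apply/funext => w; case: ifPn => [le|nle].
  have E : limn_einf (u w) = limn_esup (u w).
    by apply/eqP; rewrite eq_le le limn_einf_sup.
  rewrite is_cvg_limn_esupE//; apply/cvg_ex; exists (limn_esup (u w)).
  apply: (@squeeze_cvge _ _ _ _ (einfs (u w)) _ (esups (u w))).
  - apply: nearW => n; apply/andP; split.
      by apply: ereal_inf_lbound; exists n => /=.
    by apply: ereal_sup_ubound; exists n => /=.
  - by rewrite -E limn_einf_lim; exact: is_cvg_einfs.
  - by rewrite limn_esup_lim; exact: is_cvg_esups.
apply: dvgP => cu; move: nle.
by rewrite (is_cvg_limn_esupE cu) (is_cvg_limn_einfE cu) lexx.
Qed.

End UrnMeasurability.
End Urn.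

Lemma card_ord_lt_le (A a : nat) : (a <= A)%N -> #|[pred i : 'I_A | (i < a)%N]| = a.
Proof.
by move=> aA; rewrite -sum1_card (big_ord_narrow aA) sum1_card card_ord.
Qed.

Lemma ereal_inf_bigmin {R : realType} (I : finType) (Q : pred I) (f : I -> \bar R) :
  ereal_inf [set f i | i in [set i | Q i]] = (\big[mine/+oo]_(i | Q i) f i)%E.
Proof.
apply/eqP; rewrite eq_le; apply/andP; split.
  apply/bigmin_geP; split; first exact: leey.
  by move=> i Qi; apply: ereal_inf_lbound; exists i.
by apply: le_ereal_inf_tmp => _ [i /= Qi <-]; exact: bigmin_le_cond.
Qed.

Lemma exponential_prob_itvNy0 {R : realType} (r : R) : 0 < r ->
  exponential_prob r `]-oo, 0] = 0%E.
Proof.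
move=> r0; have mpdf := @measurable_exponential_pdf R r.
transitivity (\int[lebesgue_measure]_(x in `]-oo, 0%R]) (cst 0 x : \bar R))%E;
  last exact: integral0.
apply: ge0_ae_eq_integral => //.
- by apply/measurable_EFinP; exact: measurable_funTS.
- by move=> x _; rewrite lee_fin; apply: exponential_pdf_ge0; exact: ltW.
- exists [set 0]; split; [exact: measurable_set1|exact: lebesgue_measure_set1|].
  apply: subsetCl => x /= x0; rewrite in_itv/= le_eqVlt => /orP[/eqP //|xlt].
  by rewrite lt0_exponential_pdf.
Qed.

(** * Asymptotics of the limiting composition *)

Section UrnAsymptotics.
Context {R : realType} {d : measure_display} {Omega : measurableType d}.
Variables (P : probability Omega R) (A : nat) (F : 'I_A -> nat -> R)
  (X0 : 'I_A -> nat) (tau : 'I_A -> nat -> Omega -> R).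
Hypothesis F_gt0 : forall i k, (0 < k)%N -> 0 < F i k.
Hypothesis X0_gt0 : forall i, (0 < X0 i)%N.
Hypothesis mtau : forall i k, measurable_fun setT (tau i k).
Hypothesis tau_law : forall i k, (X0 i <= k)%N -> forall B : set R, measurable B ->
  P (tau i k @^-1` B) = exponential_prob (F i k) B.
Hypothesis tau_indep : sojourn_independent P X0 tau.

(* [tau] may be negative on a null set; its positive part has monotone partial
   sums everywhere. *)
Let pos i k w : R := Num.max 0 (tau i k w).
Let T := explosion_time X0 tau.

Let pos_ge0 i k w : 0 <= pos i k w.
Proof. by rewrite /pos le_max lexx. Qed.

Let mmax : measurable_fun setT (fun x : R => Num.max 0 x).
Proof. by apply: measurable_maxr => //; exact: measurable_cst. Qed.

Let mpos i k : measurable_fun setT (pos i k).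
Proof. by apply: measurable_maxr => //; exact: measurable_cst. Qed.

Lemma ae_tau_gt0 : {ae P, forall w, forall i l, (X0 i <= l)%N -> 0 < tau i l w}.
Proof.
apply: filter_forall => i; apply: ae_foralln => l.
have [il|li] := leqP (X0 i) l; last by apply/aeW => w.
have Fil : 0 < F i l by apply: F_gt0; exact: leq_trans (X0_gt0 i) il.
exists (tau i l @^-1` `]-oo, 0]); split.
- by rewrite -[X in measurable X]setTI; exact: mtau.
- by rewrite tau_law// exponential_prob_itvNy0.
- by move=> w /= /not_implyP[_ /negP]; rewrite in_itv/= -leNgt.
Qed.

Let posE w : (forall i l, (X0 i <= l)%N -> 0 < tau i l w) ->
  forall i l, (X0 i <= l)%N -> pos i l w = tau i l w.
Proof. by move=> tw i l il; rewrite /pos max_r// ltW// tw. Qed.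

Let pos_law i k : (X0 i <= k)%N -> forall B : set R, measurable B ->
  P (pos i k @^-1` B) = exponential_prob (F i k) B.
Proof.
move=> ik B mB; rewrite -tau_law//; apply: ae_measure_eq.
- by rewrite -[X in measurable X]setTI; exact: mpos.
- by rewrite -[X in measurable X]setTI; exact: mtau.
- by apply: filterS ae_tau_gt0 => w tw; rewrite /preimage /= posE.
Qed.

Let pos_indep : sojourn_independent P X0 pos.
Proof.
move=> J B uJ JX mB.
(* An event for [pos] is an event for [tau] whose test sets are pulled back along the positive
   part. *)
have := tau_indep uJ JX (B := fun j => (fun x => Num.max 0 x) @^-1` B j).
apply=> j; rewrite -[X in measurable X]setTI; exact: mmax.
Qed.

Let tailE w : (forall i l, (X0 i <= l)%N -> 0 < tau i l w) ->
  forall i, tail pos i (X0 i) w = T i w.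
Proof.
move=> tw i; rewrite /tail /T /explosion_time.
apply: congr_lim; apply/funext => n; apply: eq_big_nat => l /andP[il _].
by rewrite posE.
Qed.

Let psumE w : (forall i l, (X0 i <= l)%N -> 0 < tau i l w) ->
  forall i n, psum pos i (X0 i) n w = \sum_(X0 i <= l < n) tau i l w.
Proof.
by move=> tw i n; apply: eq_big_nat => l /andP[il _]; rewrite posE.
Qed.

Let restE (I : {set 'I_A}) w : (forall i l, (X0 i <= l)%N -> 0 < tau i l w) ->
  rest X0 pos I w = ereal_inf [set T k w | k in [set k | k \notin I]].
Proof.
move=> tw; rewrite ereal_inf_bigmin /rest.
by apply: eq_bigr => i _; rewrite tailE.
Qed.

(* On the window event [T* = min_j T_j] is attained outside [I], because
   [T* <= sigma_i (x_i + 1) < T_i] for [i] in [I]. *)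
Lemma urn_limit_window (I : {set 'I_A}) x w :
  (forall i l, (X0 i <= l)%N -> 0 < tau i l w) ->
  rest X0 pos I w \is a fin_num -> (forall i, i \in I -> (X0 i <= x i)%N) ->
  (forall i, i \in I -> urn_limit_is X0 tau i (x i) w) <-> window X0 pos I x w.
Proof.
move=> tw Sfin Ix.
have sT i k : ((\sum_(X0 i <= l < k) tau i l w)%:E < T i w)%E.
  exact: sigma_lt_explosion.
have Tm_le i : (rest X0 pos finset.set0 w <= T i w)%E.
  by rewrite -tailE//; apply: rest_le; rewrite finset.in_set0.
have [j jI Sj] : exists2 j, j \notin I & rest X0 pos I w = T j w.
  have [Soo|[j jI Sj]] := rest_cases X0 pos I w; first by rewrite Soo in Sfin.
  by exists j => //; rewrite Sj tailE.
(* The minimum over all agents is attained, by [j] if it is infinite. *)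
have [j0 Tm0] : exists j0, T j0 w = rest X0 pos finset.set0 w.
  have [Soo|[j0 _ ->]] := rest_cases X0 pos finset.set0 w; last by exists j0; rewrite tailE.
  by exists j; apply/eqP; rewrite eq_le Tm_le Soo leey.
have Tm_rest : (rest X0 pos finset.set0 w <= rest X0 pos I w)%E by rewrite Sj.
have urnP i : i \in I -> urn_limit_is X0 tau i (x i) w <->
    ((psum pos i (X0 i) (x i) w)%:E < rest X0 pos finset.set0 w)%E /\
    (rest X0 pos finset.set0 w <= (psum pos i (X0 i) (x i).+1 w)%:E)%E.
  by move=> iI; rewrite !psumE//; exact: (urn_limitP tw Tm_le Tm0 (Ix i iI)).
have SE : rest X0 pos I w = (rtime X0 pos I w)%:E by rewrite /rtime fineK.
suff TmE : (forall i, i \in I ->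
    (rest X0 pos finset.set0 w <= (psum pos i (X0 i) (x i).+1 w)%:E)%E) \/
    window X0 pos I x w -> rest X0 pos finset.set0 w = rest X0 pos I w.
  split => h.
    have hm : rest X0 pos finset.set0 w = rest X0 pos I w.
      by apply: TmE; left => i iI; have /(urnP i iI)[] := h i iI.
    by move=> i iI; have /(urnP i iI) := h i iI; rewrite hm SE lte_fin lee_fin => -[-> ->].
  have hm : rest X0 pos finset.set0 w = rest X0 pos I w by apply: TmE; right.
  move=> i iI; apply/(urnP i iI); rewrite hm SE lte_fin lee_fin.
  by have /andP[] := h i iI.
move=> h; apply/eqP; rewrite eq_le Tm_rest /= -Tm0.
have [j0I|j0I] := boolP (j0 \in I); last by rewrite -tailE//; exact: rest_le.
case: h => [/(_ j0 j0I)|/(_ j0 j0I) /andP[_]].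
  by rewrite -Tm0 psumE// leNgt sT.
rewrite psumE// -lee_fin -SE => /le_trans; apply; exact/ltW/sT.
Qed.

(** [window_limit] carried over from [pos] to [tau]: off a null set all clocks are positive, the
    explosion times coincide, and the limit event is the window. *)
Lemma urn_limit_asymptotics (I : {set 'I_A}) j (g : 'I_A -> R -> R)
    (x : nat -> 'I_A -> nat)
    (S := fun w => ereal_inf [set T k w | k in [set k | k \notin I]])
    (L := fine (\int[P]_w (\prod_(i in I) g i (fine (S w)))%:E)%E) :
  j \notin I -> summable_feedback (F j) ->
  (forall i, i \in I -> summable_feedback (F i)) ->
  (forall i, i \in I -> is_density P (T i) (g i)) ->
  (forall n i, i \in I -> (n <= x n i)%N) ->
  0 < L /\
  (\prod_(i in I) F i (x n i)) *
    fine (P [set w | forall i, i \in I -> urn_limit_is X0 tau i (x n i) w])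
    @[n --> \oo] --> L.
Proof.
move=> jI Fj FI gI nx.
have mT i : measurable_fun setT (T i) by exact: measurable_explosion_time.
have mtail i : measurable_fun setT (tail pos i (X0 i)) by exact: measurable_tailT.
have gI' i : i \in I -> is_density P (tail pos i (X0 i)) (g i).
  move=> iI; have [mg [g0 gE]] := gI i iI; split => //; split => // B mB.
  rewrite -gE//; apply: ae_measure_eq.
  - by rewrite -[X in measurable X]setTI; apply: mtail => //; exact: measurable_image_EFin.
  - by rewrite -[X in measurable X]setTI; apply: mT => //; exact: measurable_image_EFin.
  - by apply: filterS ae_tau_gt0 => w tw; rewrite /preimage /= tailE.
have [] := window_limit X0_gt0 F_gt0 pos_ge0 mpos pos_law pos_indep jI Fj FI gI' nx.
have -> : fine (\int[P]_w (\prod_(i in I) g i (rtime X0 pos I w))%:E)%E = L.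
  congr fine; apply: ge0_ae_eq_integral => //.
  - apply/measurable_EFinP.
    rewrite (_ : (fun w => _) = fun w => \prod_(i <- enum I) g i (rtime X0 pos I w)).
      apply: measurable_prod => i; rewrite mem_enum => /gI[mg _].
      by apply: measurableT_comp => //; exact: measurable_rtimeT.
    by apply/funext => w; rewrite big_enum.
  - apply/measurable_EFinP.
    rewrite (_ : (fun w => _) = fun w => \prod_(i <- enum I) g i (fine (S w))).
      apply: measurable_prod => i; rewrite mem_enum => /gI[mg _].
      apply: measurableT_comp => //; apply: measurableT_comp => //.
      rewrite (_ : S = fun w => \big[mine/+oo%E]_(k <- enum (~: I)) T k w).
        elim: (enum _) => [|k s ih].
          by under eq_fun do rewrite big_nil; exact: measurable_cst.
        by under eq_fun do rewrite big_cons; exact: measurable_mine.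
      apply/funext => w; rewrite /S ereal_inf_bigmin big_enum.
      by apply: eq_bigl => k; rewrite inE.
    by apply/funext => w; rewrite big_enum.
  - by move=> w _; rewrite lee_fin; apply: prodr_ge0 => i /gI[_ [g0 _]].
  - by move=> w _; rewrite lee_fin; apply: prodr_ge0 => i /gI[_ [g0 _]].
  - by apply: filterS ae_tau_gt0 => w tw _; rewrite /rtime restE.
move=> L0 cvgL; split => //; move: cvgL; apply: cvg_trans; apply: near_eq_cvg; near=> n.
have Ix i : i \in I -> (X0 i <= x n i)%N.
  move=> iI; apply: leq_trans (nx n i iI).
  apply: leq_trans (_ : \max_i X0 i <= n)%N; first exact: leq_bigmax.
  by near: n; exact: nbhs_infty_ge.
congr (_ * fine _); apply: ae_measure_eq.
- exact: measurable_window.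
- rewrite (_ : [set w | _] = \bigcap_(i in [set i | i \in I]) urn_limit_is X0 tau i (x n i)).
    apply: fin_bigcap_measurable => [|i _]; first exact: finite_finset.
    exact: measurable_urn_limit.
  by apply/seteqP; split => w.
- move: (ae_rest_fin X0_gt0 F_gt0 pos_ge0 mpos pos_law jI Fj) ae_tau_gt0.
  by apply: filterS2 => w Sfin tw; apply: iff_sym; exact: urn_limit_window.
Unshelve. all: by end_near. Qed.

End UrnAsymptotics.

Unset Implicit Arguments.

Theorem theorem3 (R : realType) (d : measure_display) (Omega : measurableType d)
  (P : probability Omega R) (A : nat) (F : 'I_A -> nat -> R)
  (X0 : 'I_A -> nat) (tau : 'I_A -> nat -> Omega -> R)
  (g : 'I_A -> R -> R) (a : nat) :
  (2 <= A)%N ->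
  (1 <= a)%N -> (a <= A - 1)%N ->
  (forall i k, (0 < k)%N -> 0 < F i k) ->
  (forall i, (0 < X0 i)%N) ->
  (forall i k, measurable_fun [set: Omega] (tau i k)) ->
  (forall i k, (X0 i <= k)%N -> forall B : set R, measurable B ->
     P (tau i k @^-1` B) = exponential_prob (F i k) B) ->
  sojourn_independent P X0 tau ->
  (a.+1 <= #|[set j : 'I_A | `[< summable_feedback (F j) >]]|)%N ->
  (forall i : 'I_A, (i < a)%N -> summable_feedback (F i)) ->
  (forall i : 'I_A, summable_feedback (F i) ->
     is_density P (explosion_time X0 tau i) (g i)) ->
  let T := explosion_time X0 tau in
  let S := fun w => ereal_inf [set T i w | i in [set i : 'I_A | (a <= i)%N]] in
  let S_ := fun (i : 'I_A) w => ereal_inf [set T j w | j in [set j : 'I_A | j != i]] in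
  let C := fine (\int[P]_w (\prod_(i : 'I_A | (i < a)%N) g i (fine (S w)))%:E)%E /
           \prod_(i : 'I_A | (i < a)%N) fine (\int[P]_w (g i (fine (S_ i w)))%:E)%E in
  forall eps : R, 0 < eps -> exists M : nat, forall x : 'I_A -> nat,
    (forall i : 'I_A, (i < a)%N -> (M <= x i)%N) ->
    `| fine (P [set w | forall i : 'I_A, (i < a)%N -> urn_limit_is X0 tau i (x i) w])
       / (C * \prod_(i : 'I_A | (i < a)%N) fine (P (urn_limit_is X0 tau i (x i))))
       - 1 | < eps.
Proof.
move=> A2 a1 aA F_gt0 X0_gt0 mtau law indep card Fa dens T S S_ C eps eps0.
pose Ia : {set 'I_A} := [set i : 'I_A | (i < a)%N]%SET.
have inIa i : (i \in Ia) = (i < a)%N by rewrite inE.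
(* At least [a + 1] summable agents do not fit into [I]. This serves both the first [a] agents and
   the singletons, as [1 <= a]. *)
have exj (I : {set 'I_A}) : (#|I| <= a)%N -> exists2 j, j \notin I & summable_feedback (F j).
  move=> Icard; apply: contrapT => /forall2NP h; move: card; apply/negP; rewrite -leqNgt.
  apply: leq_trans Icard; apply: subset_leq_card; apply/fintype.subsetP => j.
  rewrite inE => /asboolP Fj; apply: contraT => jI; by case: (h j).
(* [M] has to be uniform in [x]. If none works, choosing a counterexample for each [M] gives a
   sequence whose first [a] coordinates tend to infinity, to which the sequential limits apply. *)
apply: contrapT => /forallNP noM.
have /choice[x Hx] : forall M, exists x : 'I_A -> nat,
    (forall i : 'I_A, (i < a)%N -> (M <= x i)%N) /\
    ~~ (`| fine (P [set w | forall i : 'I_A, (i < a)%N -> urn_limit_is X0 tau i (x i) w])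
       / (C * \prod_(i : 'I_A | (i < a)%N) fine (P (urn_limit_is X0 tau i (x i))))
       - 1 | < eps).
  by move=> M; have /existsNP[x /not_implyP[h /negP h2]] := noM M; exists x.
have nx n (i : 'I_A) : (i < a)%N -> (n <= x n i)%N by move=> ia; have [/(_ i ia)] := Hx n.
pose pA n := fine (P [set w | forall i : 'I_A, (i < a)%N -> urn_limit_is X0 tau i (x n i) w]).
pose p i n := fine (P (urn_limit_is X0 tau i (x n i))).
pose LA := fine (\int[P]_w (\prod_(i : 'I_A | (i < a)%N) g i (fine (S w)))%:E)%E.
pose Li i := fine (\int[P]_w (g i (fine (S_ i w)))%:E)%E.
have asym := @urn_limit_asymptotics _ _ _ P A F X0 tau F_gt0 X0_gt0 mtau law indep.
have [LA0 cvgA] : 0 < LA /\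
    (\prod_(i : 'I_A | (i < a)%N) F i (x n i)) * pA n @[n --> \oo] --> LA.
  have [|j jI Fj] := exj Ia.
    by rewrite -[leqRHS](@card_ord_lt_le A)//; [rewrite (eq_card inIa)|lia].
  have [||| L0 cL] := asym Ia j g x jI Fj.
  - by move=> i; rewrite inIa => /Fa.
  - by move=> i; rewrite inIa => /Fa /dens.
  - by move=> n i; rewrite inIa; exact: nx.
  have SE w : ereal_inf [set T k w | k in [set k | k \notin Ia]] = S w.
    congr ereal_inf; congr image; apply/seteqP; split => k /=; by rewrite inIa -leqNgt.
  have LE : fine (\int[P]_w (\prod_(i in Ia) g i (fine
      (ereal_inf [set T k w | k in [set k | k \notin Ia]])))%:E)%E = LA.
    congr fine; apply: eq_integral => w _; congr EFin.
    by rewrite SE; apply: eq_bigl => i; rewrite inIa.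
  rewrite LE in L0 cL; split => //; apply: cvg_trans cL; apply: near_eq_cvg; near=> n.
  congr (_ * fine (P _)); first by apply: eq_bigl => i; rewrite inIa.
  by apply/seteqP; split => w /= h i ia; apply: h; rewrite ?inIa// -inIa.
have Lip (i : 'I_A) : (i < a)%N -> 0 < Li i /\ F i (x n i) * p i n @[n --> \oo] --> Li i.
  move=> ia; have [|j jI Fj] := exj [set i]%SET; first by rewrite cards1.
  have [||| L0 cL] := asym [set i]%SET j g x jI Fj.
  - by move=> k; rewrite finset.in_set1 => /eqP ->; exact: Fa.
  - by move=> k; rewrite finset.in_set1 => /eqP ->; exact/dens/Fa.
  - by move=> n k; rewrite finset.in_set1 => /eqP ->; exact: nx.
  have SE w : ereal_inf [set T k w | k in [set k | k \notin [set i]%SET]] = S_ i w.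
    congr ereal_inf; congr image; apply/seteqP; split => k /=; by rewrite finset.in_set1.
  have LE : fine (\int[P]_w (\prod_(k in [set i]%SET) g k (fine
      (ereal_inf [set T k w | k in [set k | k \notin [set i]%SET]])))%:E)%E = Li i.
    by congr fine; apply: eq_integral => w _; congr EFin; rewrite SE big_set1.
  rewrite LE in L0 cL; split => //; apply: cvg_trans cL; apply: near_eq_cvg; near=> n.
  rewrite big_set1; congr (_ * fine (P _)); apply/seteqP; split => w /=.
    by apply; rewrite finset.in_set1.
  by move=> h k; rewrite finset.in_set1 => /eqP ->.
have prodL0 : 0 < \prod_(i : 'I_A | (i < a)%N) Li i.
  by apply: prodr_gt0 => i /Lip[].
have cvgprod : \prod_(i : 'I_A | (i < a)%N) (F i (x n i) * p i n) @[n --> \oo] -->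
    \prod_(i : 'I_A | (i < a)%N) Li i.
  rewrite -big_filter; under eq_fun do rewrite -big_filter.
  by apply: cvg_prod_seq => i; rewrite mem_filter => /andP[/Lip[]].
(* The constant [C] is the quotient of the two limits, so the limiting ratio is 1. *)
have CE : C * \prod_(i : 'I_A | (i < a)%N) Li i = LA.
  by rewrite /C -/LA mulfVK// gt_eqF.
have ratio : (\prod_(i : 'I_A | (i < a)%N) F i (x n i) * pA n) /
    (C * \prod_(i : 'I_A | (i < a)%N) (F i (x n i) * p i n)) @[n --> \oo] --> (1 : R).
  suff : (\prod_(i : 'I_A | (i < a)%N) F i (x n i) * pA n) /
      (C * \prod_(i : 'I_A | (i < a)%N) (F i (x n i) * p i n)) @[n --> \oo] -->
      LA / (C * \prod_(i : 'I_A | (i < a)%N) Li i).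
    by rewrite CE divff// gt_eqF.
  apply: cvgM => //.
  apply: cvgV; first by rewrite CE gt_eqF.
  by apply: cvgM => //; exact: cvg_cst.
have [N _ HN] : \forall n \near \oo, `|pA n / (C * \prod_(i : 'I_A | (i < a)%N) p i n) - 1| < eps.
  (* For [n > 0] each [x n i] with [i < a] is positive, so the factors [F i (x n i)] are nonzero and
     cancel. *)
  near=> n; have Fn : \prod_(i : 'I_A | (i < a)%N) F i (x n i) != 0.
    rewrite gt_eqF//; apply: prodr_gt0 => i ia; apply: F_gt0.
    by apply: leq_trans (nx n i ia); near: n; exact: nbhs_infty_gt.
  have -> : pA n / (C * \prod_(i : 'I_A | (i < a)%N) p i n) =
      (\prod_(i : 'I_A | (i < a)%N) F i (x n i) * pA n) /
      (C * \prod_(i : 'I_A | (i < a)%N) (F i (x n i) * p i n)).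
    by rewrite big_split/= (mulrCA C) -mulf_div divff// mul1r.
  by rewrite distrC; near: n; move/cvgrPdist_lt : ratio; exact.
by have [_ /negP] := Hx N; apply; exact: (HN N (leqnn N)).
Unshelve. all: by end_near. Qed.
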